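(* Let $k$ be an infinite $C_1$ field with $\operatorname{char}k\neq 2$, and let $\mathcal{Q}^1\subset\mathcal{T}_{2,1,1}$ be a conic bundle over $\mathbb{P}^1$ of multidegree $(4,3,3,2,2,2)$ with image $X_4=\phi(\mathcal{Q}^1)\subset\mathbb{P}^3$. If there exist two points $p,q\in\mathcal{Q}^1\setminus\{y_0=0\}$ (defined over $k$) on distinct fibers of the conic bundle such that $T_{\phi(p)}X_4=T_{\phi(q)}X_4$, and $\mathcal{Q}^1$ is otherwise general, then $\mathcal{Q}^1$ is unirational over $k$.
   Context: $\mathcal{T}_{2,1,1}=\mathbb{P}(\mathcal{O}_{\mathbb{P}^1}(2)\oplus\mathcal{O}_{\mathbb{P}^1}(1)\oplus\mathcal{O}_{\mathbb{P}^1}(1))$ is the toric variety with Cox ring $k[x_0,x_1,y_0,y_1,y_2]$, $\deg x_i=(1,0)$, $\deg y_0=(-2,1)$, $\deg y_1=\deg y_2=(-1,1)$, irrelevant ideal $(x_0,x_1)\cap(y_0,y_1,y_2)$. A conic bundle of multidegree $(4,3,3,2,2,2)$ is $$\mathcal{Q}^1=\{\sigma_{0,0}y_0^2+\sigma_{0,1}y_0y_1+\sigma_{0,2}y_0y_2+\sigma_{1,1}y_1^2+\sigma_{1,2}y_1y_2+\sigma_{2,2}y_2^2=0\}\subset\mathcal{T}_{2,1,1}$$ with $\sigma_{0,0}\in k[x_0,x_1]_4$, $\sigma_{0,1},\sigma_{0,2}\in k[x_0,x_1]_3$, $\sigma_{1,1},\sigma_{1,2},\sigma_{2,2}\in k[x_0,x_1]_2$,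 projecting to $\mathbb{P}^1_{[x_0:x_1]}$. The map $\phi:\mathcal{T}_{2,1,1}\to\mathbb{P}^3$, $(x_0,x_1,y_0,y_1,y_2)\mapsto[x_0y_0:x_1y_0:y_1:y_2]$, sends $\mathcal{Q}^1$ onto a quartic surface $X_4\subset\mathbb{P}^3_{[z_0:z_1:z_2:z_3]}$ that is double along the line $\{z_0=z_1=0\}$. $T_xX_4\subset\mathbb{P}^3$ denotes the projective tangent plane at $x$. ''Otherwise general'' means general among such conic bundles subject to the stated tangency condition. A field is $C_1$ if every homogeneous form of degree $d>0$ in more than $d$ variables has a nontrivial zero. *)

(* Defs.v *)
From HB Require Import structures.
From mathcomp Require Import all_boot all_order all_algebra.
From mathcomp Require Import mpoly ring.

Set Implicit Arguments.
Unset Strict Implicit.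
Unset Printing Implicit Defensive.

Import GRing.Theory.
Local Open Scope ring_scope.

Definition infinite_field (k : fieldType) : Prop :=
  forall s : seq k, exists x : k, x \notin s.

Definition C1_field (k : fieldType) : Prop :=
  forall (d n : nat) (f : {mpoly k[n]}),
    (0 < d)%N -> (d < n)%N -> f \is d.-homog ->
    exists v : 'I_n -> k, (exists i, v i != 0) /\ f.@[v] = 0.

(* The index of each Cox coordinate of T_{2,1,1} in a vector (x0,x1,y0,y1,y2). *)
Definition ix0 : 'I_5 := @Ordinal 5 0 isT.
Definition ix1 : 'I_5 := @Ordinal 5 1 isT.
Definition iy0 : 'I_5 := @Ordinal 5 2 isT.
Definition iy1 : 'I_5 := @Ordinal 5 3 isT.
Definition iy2 : 'I_5 := @Ordinal 5 4 isT.

Definition iz0 : 'I_4 := @Ordinal 4 0 isT.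
Definition iz1 : 'I_4 := @Ordinal 4 1 isT.
Definition iz2 : 'I_4 := @Ordinal 4 2 isT.
Definition iz3 : 'I_4 := @Ordinal 4 3 isT.

(* p vanishes at the point v with coordinates in an extension iota : k -> K. *)
Definition vanishes_at (k K : fieldType) (iota : {rmorphism k -> K}) (n : nat)
    (p : {mpoly k[n]}) (v : 'rV[K]_n) : Prop :=
  (map_mpoly iota p).@[fun i => v 0 i] = 0.

(* P lies off the zero locus of the irrelevant ideal.  As Pic of a field is
   trivial, every K-point of T_{2,1,1} is the class of such a P in K^5, which is
   unique up to the torus (K^* )^2; the conditions imposed on P below are all
   invariant under this torus. *)
Definition cox_point (K : fieldType) (P : 'rV[K]_5) : bool :=
  ((P 0 ix0 != 0) || (P 0 ix1 != 0)) &&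
  [|| P 0 iy0 != 0, P 0 iy1 != 0 | P 0 iy2 != 0].

(* m is the exponent of a monomial of degree (a, b), where deg x_i = (1,0),
   deg y_0 = (-2,1) and deg y_1 = deg y_2 = (-1,1). *)
Definition has_bidegree (a b : int) (m : 'X_{1..5}) : bool :=
  ((m ix0)%:Z + (m ix1)%:Z - 2 * (m iy0)%:Z - (m iy1)%:Z - (m iy2)%:Z == a) &&
  ((m iy0)%:Z + (m iy1)%:Z + (m iy2)%:Z == b).

Definition bihomogeneous (k : fieldType) (g : {mpoly k[5]}) : Prop :=
  exists a b : int, all (has_bidegree a b) (msupp g).

(* The value at (u, v) of the binary form of degree d with coefficients c. *)
Definition binary_form (k : fieldType) (d : nat) (c : 'rV[k]_d.+1)
    (A : comAlgType k) (u v : A) : A :=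
  \sum_(i < d.+1) c 0 i *: (u ^+ (d - i) * v ^+ i).

(* The forms sigma_{i,j}, given by their coefficients. *)
Record conic_bundle (k : fieldType) := ConicBundle {
  sigma00 : 'rV[k]_5;
  sigma01 : 'rV[k]_4;
  sigma02 : 'rV[k]_4;
  sigma11 : 'rV[k]_3;
  sigma12 : 'rV[k]_3;
  sigma22 : 'rV[k]_3
}.

Section ConicBundle.
Variables (k : fieldType) (Q : conic_bundle k).

Definition conic_eq : {mpoly k[5]} :=
  let s d (c : 'rV[k]_d.+1) := binary_form c ('X_ix0 : {mpoly k[5]}) 'X_ix1 in
    s _ (sigma00 Q) * 'X_iy0 ^+ 2 + s _ (sigma01 Q) * 'X_iy0 * 'X_iy1
  + s _ (sigma02 Q) * 'X_iy0 * 'X_iy2 + s _ (sigma11 Q) * 'X_iy1 ^+ 2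
  + s _ (sigma12 Q) * 'X_iy1 * 'X_iy2 + s _ (sigma22 Q) * 'X_iy2 ^+ 2.

Definition on_conic_bundle (K : fieldType) (iota : {rmorphism k -> K})
    (P : 'rV[K]_5) : Prop :=
  cox_point P /\ vanishes_at iota conic_eq P.

(* The equation of X_4: substituting z = phi(x, y) gives y_0 ^ 2 times conic_eq,
   and quartic_image below says that its zero locus is the image of phi. *)
Definition quartic : {mpoly k[4]} :=
  let s d (c : 'rV[k]_d.+1) := binary_form c ('X_iz0 : {mpoly k[4]}) 'X_iz1 in
    s _ (sigma00 Q) + s _ (sigma01 Q) * 'X_iz2 + s _ (sigma02 Q) * 'X_iz3
  + s _ (sigma11 Q) * 'X_iz2 ^+ 2 + s _ (sigma12 Q) * 'X_iz2 * 'X_iz3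
  + s _ (sigma22 Q) * 'X_iz3 ^+ 2.

(* A rational map from P^n to Q^1 over k is a point of Q^1 with values in
   k(t_1,...,t_n).  It is dominant when the image of that point is dense, i.e.,
   when every closed subset of T_{2,1,1} through it (cut out by bihomogeneous
   elements of the Cox ring) contains all the points of the scheme Q^1. *)
Definition unirational : Prop :=
  exists (n : nat) (psi : 'rV[{fraction {mpoly k[n]}}]_5),
    let iota : {rmorphism k -> {fraction {mpoly k[n]}}} :=
      @tofrac {mpoly k[n]} \o @mpolyC n k in
    on_conic_bundle iota psi /\
    forall g : {mpoly k[5]}, bihomogeneous g -> vanishes_at iota g psi ->
      forall (K : fieldType) (kappa : {rmorphism k -> K}) (P : 'rV[K]_5),
        on_conic_bundle kappa P -> vanishes_at kappa g P.

End ConicBundle.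

Definition phi (K : fieldType) (P : 'rV[K]_5) : 'rV[K]_4 :=
  \row_i tnth [tuple P 0 ix0 * P 0 iy0; P 0 ix1 * P 0 iy0; P 0 iy1; P 0 iy2] i.

Lemma binary_form_eval (k K : fieldType) (iota : {rmorphism k -> K}) (n d : nat)
    (c : 'rV[k]_d.+1) (i j : 'I_n) (w : 'I_n -> K) :
  (map_mpoly iota (binary_form c ('X_i : {mpoly k[n]}) 'X_j)).@[w] =
  \sum_(e < d.+1) iota (c 0 e) * (w i ^+ (d - e) * w j ^+ e).
Proof.
rewrite /binary_form (rmorph_sum (map_mpoly iota)) (rmorph_sum (meval w)) /=.
apply: eq_bigr => e _.
by rewrite map_mpolyZ mevalZ !rmorphM /= !rmorphXn /= !map_mpolyX !mevalXU.
Qed.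

Lemma conic_evalE (k K : fieldType) (iota : {rmorphism k -> K})
    (Q : conic_bundle k) (w : 'I_5 -> K) :
  let s d (c : 'rV[k]_d.+1) :=
    \sum_(e < d.+1) iota (c 0 e) * (w ix0 ^+ (d - e) * w ix1 ^+ e) in
  (map_mpoly iota (conic_eq Q)).@[w] =
    s _ (sigma00 Q) * w iy0 ^+ 2 + s _ (sigma01 Q) * w iy0 * w iy1
  + s _ (sigma02 Q) * w iy0 * w iy2 + s _ (sigma11 Q) * w iy1 ^+ 2
  + s _ (sigma12 Q) * w iy1 * w iy2 + s _ (sigma22 Q) * w iy2 ^+ 2.
Proof.
rewrite /conic_eq; do 5 rewrite (rmorphD (map_mpoly iota)) mevalD.
do ![congr (_ + _)]; rewrite ?rmorphM /= ?rmorphXn /= ?map_mpolyX ?mevalM;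
by rewrite ?rmorphXn /= ?mevalXU binary_form_eval.
Qed.

Lemma quartic_evalE (k K : fieldType) (iota : {rmorphism k -> K})
    (Q : conic_bundle k) (w : 'I_4 -> K) :
  let s d (c : 'rV[k]_d.+1) :=
    \sum_(e < d.+1) iota (c 0 e) * (w iz0 ^+ (d - e) * w iz1 ^+ e) in
  (map_mpoly iota (quartic Q)).@[w] =
    s _ (sigma00 Q) + s _ (sigma01 Q) * w iz2 + s _ (sigma02 Q) * w iz3
  + s _ (sigma11 Q) * w iz2 ^+ 2 + s _ (sigma12 Q) * w iz2 * w iz3
  + s _ (sigma22 Q) * w iz3 ^+ 2.
Proof.
rewrite /quartic; do 5 rewrite (rmorphD (map_mpoly iota)) mevalD.
do ![congr (_ + _)]; rewrite ?rmorphM /= ?rmorphXn /= ?map_mpolyX ?mevalM;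
by rewrite ?rmorphXn /= ?mevalXU binary_form_eval.
Qed.

Lemma phiE (K : fieldType) (P : 'rV[K]_5) :
  [/\ phi P 0 iz0 = P 0 ix0 * P 0 iy0, phi P 0 iz1 = P 0 ix1 * P 0 iy0,
      phi P 0 iz2 = P 0 iy1 & phi P 0 iz3 = P 0 iy2].
Proof. by rewrite !mxE. Qed.

Lemma quartic_phi (k K : fieldType) (iota : {rmorphism k -> K})
    (Q : conic_bundle k) (P : 'rV[K]_5) :
  (map_mpoly iota (quartic Q)).@[fun i => phi P 0 i] =
  P 0 iy0 ^+ 2 * (map_mpoly iota (conic_eq Q)).@[fun i => P 0 i].
Proof.
have bfM d (c : 'rV[k]_d.+1) :
    \sum_(e < d.+1) iota (c 0 e) *
       ((P 0 ix0 * P 0 iy0) ^+ (d - e) * (P 0 ix1 * P 0 iy0) ^+ e) =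
    P 0 iy0 ^+ d * \sum_(e < d.+1) iota (c 0 e) *
                     (P 0 ix0 ^+ (d - e) * P 0 ix1 ^+ e).
  rewrite mulr_sumr; apply: eq_bigr => e _.
  have -> : P 0 iy0 ^+ d = P 0 iy0 ^+ (d - e) * P 0 iy0 ^+ e.
    by rewrite -exprD subnK // -ltnS.
  by rewrite !exprMn; ring.
have [z0 z1 z2 z3] := phiE P.
by rewrite quartic_evalE conic_evalE /= z0 z1 z2 z3 !bfM; ring.
Qed.

Lemma quartic_image (k : fieldType) (K : closedFieldType)
    (iota : {rmorphism k -> K}) (Q : conic_bundle k) (z : 'rV[K]_4) :
  z != 0 ->
  vanishes_at iota (quartic Q) z <->
  exists2 P, on_conic_bundle Q iota P & phi P = z.
Proof.
move=> nz_z; split=> [Fz|[P [_ QP] <-]]; last first.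
  by rewrite /vanishes_at quartic_phi QP mulr0.
have eqz (u v : 'rV[K]_4) : u 0 iz0 = v 0 iz0 -> u 0 iz1 = v 0 iz1 ->
    u 0 iz2 = v 0 iz2 -> u 0 iz3 = v 0 iz3 -> u = v.
  move=> h0 h1 h2 h3; apply/rowP=> i.
  have: i \in [:: iz0; iz1; iz2; iz3] by case: i => [[|[|[|[|//]]]]].
  by rewrite !inE => /or4P[]/eqP->.
pose pt a b c d e : 'rV[K]_5 := \row_i tnth [tuple a; b; c; d; e] i.
have ptE a b c d e : [/\ pt a b c d e 0 ix0 = a, pt a b c d e 0 ix1 = b,
    pt a b c d e 0 iy0 = c, pt a b c d e 0 iy1 = d & pt a b c d e 0 iy2 = e].
  by rewrite !mxE.
have phi_pt a b c d e : a * c = z 0 iz0 -> b * c = z 0 iz1 ->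
    d = z 0 iz2 -> e = z 0 iz3 -> phi (pt a b c d e) = z.
  have [z0 z1 z2 z3] := phiE (pt a b c d e); have [p0 p1 p2 p3 p4] := ptE a b c d e.
  by move=> h0 h1 h2 h3; apply: eqz; rewrite ?z0 ?z1 ?z2 ?z3 ?p0 ?p1 ?p2 ?p3 ?p4.
have [z01|] := boolP ((z 0 iz0 != 0) || (z 0 iz1 != 0)).
  set P := pt (z 0 iz0) (z 0 iz1) 1 (z 0 iz2) (z 0 iz3).
  have phiP : phi P = z by apply: phi_pt; rewrite ?mulr1.
  exists P => //; have [p0 p1 p2 _ _] := ptE (z 0 iz0) (z 0 iz1) 1 (z 0 iz2) (z 0 iz3).
  split; first by rewrite /cox_point p0 p1 p2 oner_eq0 z01.
  have := quartic_phi iota Q P; rewrite phiP p2 expr1n mul1r.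
  by rewrite /vanishes_at => <-.
rewrite negb_or !negbK => /andP[/eqP z0 /eqP z1].
have z23 : (z 0 iz2 != 0) || (z 0 iz3 != 0).
  apply: contraNT nz_z; rewrite negb_or !negbK => /andP[/eqP z2 /eqP z3].
  by apply/eqP/eqz; rewrite ?z0 ?z1 ?z2 ?z3 mxE.
pose q (e : 'I_3) := iota (sigma11 Q 0 e) * z 0 iz2 ^+ 2
  + iota (sigma12 Q 0 e) * z 0 iz2 * z 0 iz3 + iota (sigma22 Q 0 e) * z 0 iz3 ^+ 2.
have [[a b] /= nz_ab qab] : exists2 ab : K * K, (ab.1 != 0) || (ab.2 != 0) &
    \sum_(e < 3) q e * (ab.1 ^+ (2 - e) * ab.2 ^+ e) = 0.
  have [q0|nz_q0] := eqVneq (q ord0) 0.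
    exists (1, 0); rewrite /= ?oner_eq0 // !big_ord_recl big_ord0 /= q0.
    by rewrite !expr0n /=; ring.
  pose c0 := q (lift ord0 (lift ord0 ord0)); pose c1 := q (lift ord0 ord0).
  have [x] := @solve_monicpoly K 2
    (fun i => if i == 0%N then - c0 / q ord0 else - c1 / q ord0) isT.
  rewrite !big_ord_recl big_ord0 /= => ex.
  exists (x, 1); rewrite /= ?oner_eq0 ?orbT // !big_ord_recl big_ord0 /=.
  by rewrite subn0 ex -/c0 -/c1 !expr1n; field.
exists (pt a b 0 (z 0 iz2) (z 0 iz3)); last by apply: phi_pt; rewrite ?mulr0.
have [p0 p1 p2 p3 p4] := ptE a b 0 (z 0 iz2) (z 0 iz3).
split; first by rewrite /cox_point p0 p1 p3 p4 nz_ab z23 orbT.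
rewrite /vanishes_at conic_evalE /= p0 p1 p2 p3 p4 -[RHS]qab /q.
by rewrite !big_ord_recl !big_ord0; ring.
Qed.

Definition gradient (k : fieldType) (n : nat) (F : {mpoly k[n]}) (z : 'rV[k]_n) :
    'rV[k]_n :=
  \row_i (F^`M(i)).@[fun j => z 0 j].

(* The row space is the affine cone over the projective tangent space at z. *)
Definition tangent_space (k : fieldType) (n : nat) (F : {mpoly k[n]})
    (z : 'rV[k]_n) : 'M[k]_n :=
  kermx (gradient F z)^T.

(* T_{phi p} X_4 and T_{phi q} X_4 have to be planes, so X_4 is smooth at phi p
   and at phi q. *)
Definition bitangent (k : fieldType) (Q : conic_bundle k) (p q : 'rV[k]_5) : Prop :=
  [/\ on_conic_bundle Q idfun p /\ p 0 iy0 != 0,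
      on_conic_bundle Q idfun q /\ q 0 iy0 != 0,
      p 0 ix0 * q 0 ix1 != p 0 ix1 * q 0 ix0,
      gradient (quartic Q) (phi p) != 0 /\ gradient (quartic Q) (phi q) != 0
    & (tangent_space (quartic Q) (phi p) == tangent_space (quartic Q) (phi q))%MS].

(* Conic bundles subject to the tangency condition are parametrized by triples
   (Q, p, q): over an algebraic closure a general Q has a one-dimensional family
   of bitangent planes, so the condition is one on the triple, not a closed one
   on Q.  "General" refers to this incidence variety; it is irreducible with
   dense k-points when k is infinite, so its k-points carry the same notion. *)
Definition datum (k : fieldType) : Type :=
  (conic_bundle k * 'rV[k]_5 * 'rV[k]_5)%type.

Definition coords (k : fieldType) (D : datum k) : 'rV[k]_(22 + 5 + 5) :=
  let: (Q, p, q) := D in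
  row_mx (row_mx
    (row_mx (sigma00 Q) (row_mx (sigma01 Q) (row_mx (sigma02 Q)
      (row_mx (sigma11 Q) (row_mx (sigma12 Q) (sigma22 Q)))))) p) q.

Definition bitangent_datum (k : fieldType) (D : datum k) : Prop :=
  let: (Q, p, q) := D in bitangent Q p q.

Definition zariski_open (k : fieldType) (U : datum k -> Prop) : Prop :=
  exists G : seq {mpoly k[22 + 5 + 5]},
    forall D, U D <-> exists2 g, g \in G & g.@[fun i => coords D 0 i] != 0.

(* X is contained in the Zariski closure of its intersection with U. *)
Definition zariski_dense_in (k : fieldType) (X U : datum k -> Prop) : Prop :=
  forall h : {mpoly k[22 + 5 + 5]},
    (forall D, X D -> U D -> h.@[fun i => coords D 0 i] = 0) ->
    forall D, X D -> h.@[fun i => coords D 0 i] = 0.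

(* Main.v *)
(* The tangent plane H at both points meets X_4 in a plane quartic which is singular
   at phi(p), at phi(q) and where H meets the double line.  It is therefore
   birational to a conic, which has a k-point because k is C_1, so it is a rational
   curve.  The double line cuts out one double point of this quartic, so the quartic
   is a bisection of the conic bundle.  After the base change to that rational curve
   the conic bundle acquires a section, hence becomes rational over k, and it
   dominates Q^1.
     Dominance is checked at k-points: a polynomial vanishing on the image is reduced
   modulo the equation of Q^1, seen as a quadratic polynomial in y_2 (or y_1), and the
   linear remainder vanishes at two distinct roots over a dense set of k-points.
     For fixed (p, q, H), the bundles with H tangent at phi(p) and phi(q) form a
   linear space, and density follows by joining a given bundle by a line to an
   explicit general one. *)
Require Import Defs.
From mathcomp Require Import all_boot all_order all_algebra.
From mathcomp Require Import mpoly ring.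
From Stdlib Require Import Classical.

Set Implicit Arguments.
Unset Strict Implicit.
Unset Printing Implicit Defensive.

Import GRing.Theory.
Local Open Scope ring_scope.

(** * Polynomials and polynomial functions over an infinite field *)

(** A general plane cuts the conics in a double cover of the base branched over the six zeros of a
    discriminant. Each tangency makes two of these zeros collide, so after removing squares a binary
    quadratic form is left, and the bisection becomes the plane conic on which this form is a
    square. The quadratic formula then gives the section by polynomials, which lets the argument run
    with polynomial maps and [k]-points, without function fields of the conic or of the generic
    fibre. The open set is explicit: it is the nonvanishing of a product of three polynomials in the
    datum, which makes one fibre smooth, keeps the coefficients of y_1^2 and y_2^2 from vanishing
    together on a fibre, and makes the bisection smooth. *)

Lemma rmorph_mmap (n : nat) (R : nzRingType) (S T : comNzRingType)
    (f : {rmorphism R -> S}) (h : 'I_n -> S) (phi : {rmorphism S -> T})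
    (p : {mpoly R[n]}) :
  phi (mmap f h p) = mmap (phi \o f) (phi \o h) p.
Proof.
rewrite /mmap rmorph_sum; apply: eq_bigr => m _.
rewrite rmorphM /mmap1 rmorph_prod; congr (_ * _).
by apply: eq_bigr => i _; rewrite rmorphXn.
Qed.

Lemma eq_mmap (n : nat) (R S : nzRingType) (f f' : R -> S) (h h' : 'I_n -> S)
    (p : {mpoly R[n]}) :
  f =1 f' -> h =1 h' -> mmap f h p = mmap f' h' p.
Proof.
move=> ff' hh'; rewrite /mmap; apply: eq_bigr => m _.
by rewrite ff' (mmap1_eq _ hh').
Qed.

Lemma meval_map_mpoly (n : nat) (R S : comNzRingType) (f : {rmorphism R -> S})
    (v : 'I_n -> S) (p : {mpoly R[n]}) :
  (map_mpoly f p).@[v] = mmap f v p.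
Proof.
rewrite /meval /map_mpoly (rmorph_mmap _ _ (mmap idfun v)).
by apply: eq_mmap => x /=; rewrite ?mmapC ?mmapX ?mmap1U.
Qed.

Lemma rmorph_meval_map (n : nat) (R S T : comNzRingType) (f : {rmorphism R -> S})
    (phi : {rmorphism S -> T}) (v : 'I_n -> S) (p : {mpoly R[n]}) :
  phi (map_mpoly f p).@[v] = (map_mpoly (phi \o f) p).@[phi \o v].
Proof. by rewrite !meval_map_mpoly rmorph_mmap. Qed.

Lemma rmorph_muni (n : nat) (R S : comNzRingType)
    (phi : {rmorphism {poly {mpoly R[n]}} -> S}) (p : {mpoly R[n.+1]}) :
  phi (muni p) = mmap (phi \o (polyC \o @mpolyC n R))
    (fun i => match split (cast_ord (esym (addn1 n)) i) with
              | inl j => phi ('X_j)%:P | inr _ => phi 'X end) p.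
Proof.
rewrite [LHS]rmorph_mmap; apply: eq_mmap => // i.
by rewrite [LHS]/=; case: (split _).
Qed.

Lemma muni_inj (n : nat) (R : comNzRingType) : injective (@muni n R).
Proof.
pose w : {rmorphism {mpoly R[n]} -> {mpoly R[n.+1]}} :=
  mmap (@mpolyC n.+1 R) (fun i => 'X_(widen_ord (leqnSn n) i)).
pose u : {rmorphism _ -> _} :=
  horner_morph (fun a => mulrC ('X_ord_max : {mpoly R[n.+1]}) (w a)).
apply: (can_inj (g := u)) => p.
rewrite rmorph_muni -[RHS]comp_mpoly_id.
apply: eq_mmap => [c|i]; first by rewrite /= horner_morphC /= mmapC.
rewrite tnth_mktuple; case: splitP => j /= ij.
  rewrite horner_morphC /= mmapX mmap1U.
  by congr ('X_ _); apply: val_inj; rewrite /= -ij.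
rewrite horner_morphX; congr ('X_ _); apply: val_inj => /=.
by rewrite ij ord1 addn0.
Qed.

Lemma ex_nonroot (k : fieldType) (k_inf : infinite_field k) (p : {poly k}) :
  p != 0 -> exists x, p.[x] != 0.
Proof.
move=> p0; have [rs] : exists rs : seq k, uniq rs && (size p <= size rs)%N.
  elim: (size p) => [|n [s /andP[us ns]]]; first by exists [::].
  by have [x xs] := k_inf s; exists (x :: s); rewrite /= xs us.
case/andP=> urs szp.
have [/(max_poly_roots p0)/(_ urs)|] := boolP (all (root p) rs).
  by rewrite ltnNge szp.
by rewrite -has_predC => /hasP[x _ /=]; rewrite rootE; exists x.
Qed.

(** Induction on the variables: a point where the leading coefficient in the last variable survives
    leaves a nonzero univariate polynomial. *)
Lemma ex_meval_neq0 (k : fieldType) (k_inf : infinite_field k) (n : nat)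
    (f : {mpoly k[n]}) :
  f != 0 -> exists v : 'I_n -> k, f.@[v] != 0.
Proof.
elim: n f => [f f0|n IHn f f0].
  exists (fun=> 0); move: f0; rewrite (nvar0_mpolyC f) mevalC.
  by apply: contra_neq => ->; rewrite mpolyC0.
have uf0 : muni f != 0.
  by apply: contra_neq f0 => uf0; apply: muni_inj; rewrite uf0 muni0.
have /IHn[v lv] : lead_coef (muni f) != 0 by rewrite lead_coef_eq0.
pose ev : {rmorphism {mpoly k[n]} -> k} := meval v.
have /(ex_nonroot k_inf)[x fx] : map_poly ev (muni f) != 0.
  by rewrite -lead_coef_eq0 lead_coef_map_id0 ?rmorph0.
pose u : {rmorphism _ -> _} := horner_morph (fun a => mulrC x (ev a)).
have : u (muni f) != 0 by [].
rewrite rmorph_muni => uf; eexists; apply: contra_neq uf => <-.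
by apply: eq_mmap => // c; rewrite /= horner_morphC /= mevalC.
Qed.

Lemma all_roots (k : fieldType) (p : {poly k}) :
  p != 0 -> exists s : seq k, forall x, root p x -> x \in s.
Proof.
have [n] := ubnP (size p); elim: n p => // n IHn p szp p0.
have [[x px]|nx] := classic (exists x, root p x); last first.
  by exists [::] => x px; case: nx; exists x.
have [q def_p] := factor_theorem p x px.
have q0 : q != 0 by apply: contra_neq p0 => q0; rewrite def_p q0 mul0r.
have [|s hs] := IHn q _ q0.
  by move: szp; rewrite def_p size_Mmonic ?monicXsubC // size_XsubC addn2 /= ltnS.
exists (x :: s) => y; rewrite def_p rootM root_XsubC inE.
by case/orP=> [/hs ->|->]; rewrite ?orbT.
Qed.

Lemma all_roots_seq (k : fieldType) (ps : seq {poly k}) :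
  all (fun p => p != 0) ps ->
  exists s : seq k, forall p x, p \in ps -> root p x -> x \in s.
Proof.
elim: ps => [|p ps IH] /=; first by exists [::].
case/andP=> /all_roots[s hs] /IH[s' hs']; exists (s ++ s') => q x.
by rewrite inE mem_cat => /predU1P[->/hs->//|/hs' h /h ->]; rewrite orbT.
Qed.

(** Kept as a property of functions, so that composite expressions are handled by closure lemmas
    instead of explicit polynomials. *)
Definition polyfun (k : fieldType) (n : nat) (f : ('I_n -> k) -> k) : Prop :=
  exists h : {mpoly k[n]}, forall v, h.@[v] = f v.

Section PolyFun.
Variables (k : fieldType) (n : nat).
Implicit Types f g : ('I_n -> k) -> k.

Lemma polyfun_const c : polyfun (fun _ : 'I_n -> k => c).
Proof. by exists (c%:MP : {mpoly k[n]}) => v; rewrite mevalC. Qed.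

Lemma polyfun_coord i : polyfun (fun v : 'I_n -> k => v i).
Proof. by exists 'X_i => v; rewrite mevalXU. Qed.

Lemma polyfunD f g : polyfun f -> polyfun g -> polyfun (fun v => f v + g v).
Proof. by move=> [p hp] [q hq]; exists (p + q) => v; rewrite mevalD hp hq. Qed.

Lemma polyfunM f g : polyfun f -> polyfun g -> polyfun (fun v => f v * g v).
Proof. by move=> [p hp] [q hq]; exists (p * q) => v; rewrite mevalM hp hq. Qed.

Lemma polyfunN f : polyfun f -> polyfun (fun v => - f v).
Proof. by move=> [p hp]; exists (- p) => v; rewrite mevalN hp. Qed.

Lemma polyfunX f m : polyfun f -> polyfun (fun v => f v ^+ m).
Proof. by move=> [p hp]; exists (p ^+ m) => v; rewrite rmorphXn /= hp. Qed.

Lemma polyfun_sum (I : Type) (r : seq I) (F : I -> ('I_n -> k) -> k) :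
  (forall i, polyfun (F i)) -> polyfun (fun v => \sum_(i <- r) F i v).
Proof.
move=> hF; elim: r => [|i r [p hp]].
  by exists 0 => v; rewrite meval0 big_nil.
have [q hq] := hF i.
by exists (q + p) => v; rewrite mevalD hp hq big_cons.
Qed.

End PolyFun.

(** On the line joining [v] (t = 0) to [w] (t = 1) all three become univariate polynomials. The one
    from [g] is nonzero because of [w], and [e] excludes finitely many further parameters, so the
    one from [h] has infinitely many roots. *)
Lemma dense_on_line (k : fieldType) (k_inf : infinite_field k) (n : nat)
    (h g : {mpoly k[n]}) (e : {poly k}) (v w : 'I_n -> k) :
  let l t i := (1 - t) * v i + t * w i in
  g.@[w] != 0 -> e != 0 ->
  (forall t, g.@[l t] != 0 -> e.[t] != 0 -> h.@[l t] = 0) ->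
  h.@[v] = 0.
Proof.
move=> l gw e0 hl.
pose L i : {poly k} := (1 - 'X) * (v i)%:P + 'X * (w i)%:P.
have evL (f : {mpoly k[n]}) t : (mmap polyC L f).[t] = f.@[l t].
  rewrite -/(horner_eval t _) (rmorph_mmap _ _ (horner_eval t)).
  by apply: eq_mmap => [c|i] /=; rewrite /horner_eval ?hornerE.
have [H0|H0] := eqVneq (mmap polyC L h) 0.
  rewrite -[LHS](@meval_eq _ _ (l 0)) -?evL ?H0 ?horner0 // => i.
  by rewrite /l subr0 mul1r mul0r addr0.
have G0 : mmap polyC L g != 0.
  apply: contra_neq gw => G0; have := evL g 1; rewrite G0 horner0 => ->.
  by apply: meval_eq => i; rewrite /l subrr mul0r mul1r add0r.
have /(ex_nonroot k_inf)[t] : mmap polyC L h * mmap polyC L g * e != 0.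
  by rewrite !mulf_neq0.
rewrite !hornerM !evL !mulf_eq0 !negb_or => /andP[/andP[ht gt] et].
by rewrite hl ?eqxx in ht.
Qed.

(** * Conics *)

(** For identities modulo relations: [s] is a combination of vanishing expressions, and [a - b = s]
    is left to [ring]. *)
Lemma eq_of_subr (V : zmodType) (s a b : V) : s = 0 -> a - b = s -> a = b.
Proof. by move=> -> /subr0_eq. Qed.

Record tvec (R : Type) := TVec { tx : R; ty : R; tz : R }.

Record tform (R : Type) :=
  TForm { t00 : R; t01 : R; t02 : R; t11 : R; t12 : R; t22 : R }.

Section TernaryForms.
Variable R : comPzRingType.
Implicit Types (c : tform R) (l y z d : tvec R).

Definition tdot l y := tx l * tx y + ty l * ty y + tz l * tz y.

Definition tscale (a : R) y := TVec (a * tx y) (a * ty y) (a * tz y).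

Definition tnull y := [/\ tx y = 0, ty y = 0 & tz y = 0].

Definition teval c y :=
  t00 c * tx y ^+ 2 + t01 c * tx y * ty y + t02 c * tx y * tz y
  + t11 c * ty y ^+ 2 + t12 c * ty y * tz y + t22 c * tz y ^+ 2.

Definition tgrad c y :=
  TVec (2 * t00 c * tx y + t01 c * ty y + t02 c * tz y)
       (t01 c * tx y + 2 * t11 c * ty y + t12 c * tz y)
       (t02 c * tx y + t12 c * ty y + 2 * t22 c * tz y).

(** Half the determinant of the Hessian matrix. *)
Definition tdisc c :=
  4 * t00 c * t11 c * t22 c + t01 c * t02 c * t12 c
  - t00 c * t12 c ^+ 2 - t11 c * t02 c ^+ 2 - t22 c * t01 c ^+ 2.

(* The second intersection with the conic of the line through its point y in the
   direction d. *)
Definition tproj c y d :=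
  let a := teval c d in let b := tdot (tgrad c y) d in
  TVec (a * tx y - b * tx d) (a * ty y - b * ty d) (a * tz y - b * tz d).

Lemma teval_proj c y d : teval c y = 0 -> teval c (tproj c y d) = 0.
Proof.
have -> : teval c (tproj c y d) = teval c d ^+ 2 * teval c y.
  by case: c y d => ? ? ? ? ? ? [? ? ?] [? ? ?];
     rewrite /teval /tproj /tdot /teval /=; ring.
by move->; rewrite mulr0.
Qed.

Lemma teval_scale c a y : teval c (tscale a y) = a ^+ 2 * teval c y.
Proof. by rewrite /teval /=; ring. Qed.

Lemma tdot_scale l a y : tdot l (tscale a y) = a * tdot l y.
Proof. by rewrite /tdot /=; ring. Qed.

(** The chord through [y] and [z], taken as direction, leads back to [z] up to a factor that
    vanishes only when [z] is on the tangent at [y]; so projection from [y] reaches every other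
    point. *)
Lemma tproj_onto c y z : teval c y = 0 -> teval c z = 0 ->
  tproj c y (TVec (tx y - tx z) (ty y - ty z) (tz y - tz z)) =
  tscale (- tdot (tgrad c y) z) z.
Proof.
move=> cy cz.
have s0 : teval c y + teval c z = 0 by rewrite cy cz addr0.
have s1 : 2 * teval c y = 0 by rewrite cy mulr0.
have e1 : teval c (TVec (tx y - tx z) (ty y - ty z) (tz y - tz z)) =
    - tdot (tgrad c y) z.
  by apply: (eq_of_subr s0); rewrite /teval /tdot /=; ring.
have e2 : tdot (tgrad c y) (TVec (tx y - tx z) (ty y - ty z) (tz y - tz z)) =
    - tdot (tgrad c y) z.
  by apply: (eq_of_subr s1); rewrite /tdot /teval /=; ring.
by rewrite /tproj e1 e2 /tscale /=; congr TVec; ring.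
Qed.

(** The vector spans, together with [y], the tangent line at [y]. The form restricted to that line
    is the square of a coordinate times its value at the vector, so the conic degenerates exactly
    when this value is zero. *)
Lemma tdisc_tangent c y : tx y = 1 -> teval c y = 0 ->
  tdisc c = - teval c (TVec 0 (tz (tgrad c y)) (- ty (tgrad c y))).
Proof.
move=> y1 cy.
have s0 : (4 * t11 c * t22 c - t12 c ^+ 2) * teval c y = 0 by rewrite cy mulr0.
by apply: (eq_of_subr s0); rewrite /tdisc /teval /= y1; ring.
Qed.

End TernaryForms.

(** The gradient is the Hessian matrix applied to [y]; the three combinations below are the rows of
    its adjugate, which recover [2 * tdisc c] times [y]. *)
Lemma tgrad_nnull (k : fieldType) (two_neq0 : (2 : k) != 0) (c : tform k)
    (y : tvec k) :
  tdisc c != 0 -> ~ tnull y -> ~ tnull (tgrad c y).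
Proof.
set b := tgrad c y => dc ny [b0 b1 b2]; case: ny.
have h z s : s = 0 -> 2 * tdisc c * z = s -> z = 0.
  move=> -> /eqP; rewrite !mulf_eq0 (negPf two_neq0) (negPf dc) /=.
  by move/eqP.
have lin0 (m n o : k) : m * tx b + n * ty b + o * tz b = 0.
  by rewrite b0 b1 b2 !mulr0 !addr0.
split.
- apply: (h _ _ (lin0 (4 * t11 c * t22 c - t12 c ^+ 2)
    (t02 c * t12 c - 2 * t01 c * t22 c) (t01 c * t12 c - 2 * t02 c * t11 c))).
  by rewrite /b /tdisc /=; ring.
- apply: (h _ _ (lin0 (t02 c * t12 c - 2 * t01 c * t22 c)
    (4 * t00 c * t22 c - t02 c ^+ 2) (t01 c * t02 c - 2 * t00 c * t12 c))).
  by rewrite /b /tdisc /=; ring.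
apply: (h _ _ (lin0 (t01 c * t12 c - 2 * t02 c * t11 c)
  (t01 c * t02 c - 2 * t00 c * t12 c) (4 * t00 c * t11 c - t01 c ^+ 2))).
by rewrite /b /tdisc /=; ring.
Qed.

(** If the projection stayed in the line [l], then [r] times the form would be the product of the
    linear forms [b] and [l]. For [r] nonzero this forces the discriminant to vanish; for [r = 0] it
    forces [b = 0], against smoothness. *)
Lemma tproj_not_in_line (k : fieldType) (two_neq0 : (2 : k) != 0) (c : tform k)
    (y l : tvec k) :
  tdisc c != 0 -> ~ tnull y -> ~ tnull l ->
  (forall d, tdot l (tproj c y d) = 0) -> False.
Proof.
case: l => l0 l1 l2 dc ny nl ld.
pose b := tgrad c y; pose r := tdot (TVec l0 l1 l2) y.
have E d : teval c d * r - tdot b d * tdot (TVec l0 l1 l2) d = 0.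
  by rewrite -[RHS](ld d) /r /b /tproj /tdot /=; ring.
(* Polarization: the value at a sum of two basis vectors, minus the values at these vectors, gives
   the mixed coefficient. *)
have E3 d d' d'' := f_equal2 (fun u v => u - v)
  (f_equal2 (fun u v => u - v) (E d) (E d')) (E d'').
move: (E (TVec 1 0 0)) (E (TVec 0 1 0)) (E (TVec 0 0 1))
  (E3 (TVec 1 1 0) (TVec 1 0 0) (TVec 0 1 0))
  (E3 (TVec 1 0 1) (TVec 1 0 0) (TVec 0 0 1))
  (E3 (TVec 0 1 1) (TVec 0 1 0) (TVec 0 0 1)).
rewrite !subr0 => E0 E1 E2 E01 E02 E12.
have e0 : t00 c * r = tx b * l0.
  by apply: (eq_of_subr E0); rewrite /teval /tdot /=; ring.
have e1 : t11 c * r = ty b * l1.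
  by apply: (eq_of_subr E1); rewrite /teval /tdot /=; ring.
have e2 : t22 c * r = tz b * l2.
  by apply: (eq_of_subr E2); rewrite /teval /tdot /=; ring.
have e01 : t01 c * r = tx b * l1 + ty b * l0.
  by apply: (eq_of_subr E01); rewrite /teval /tdot /=; ring.
have e02 : t02 c * r = tx b * l2 + tz b * l0.
  by apply: (eq_of_subr E02); rewrite /teval /tdot /=; ring.
have e12 : t12 c * r = ty b * l2 + tz b * l1.
  by apply: (eq_of_subr E12); rewrite /teval /tdot /=; ring.
have [r0|r0] := eqVneq r 0; last first.
  case/eqP: dc.
  apply: (mulfI (expf_neq0 3 r0)); rewrite mulr0.
  have -> : r ^+ 3 * tdisc c =
      4 * (t00 c * r) * (t11 c * r) * (t22 c * r)
      + (t01 c * r) * (t02 c * r) * (t12 c * r) - (t00 c * r) * (t12 c * r) ^+ 2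
      - (t11 c * r) * (t02 c * r) ^+ 2 - (t22 c * r) * (t01 c * r) ^+ 2.
    by rewrite /tdisc; ring.
  by rewrite e0 e1 e2 e01 e02 e12; ring.
have b0 : tnull b.
  move: e0 e1 e2 e01 e02 e12; rewrite r0 !mulr0 /tnull.
  set b0 := tx b; set b1 := ty b; set b2 := tz b.
  move=> e0 e1 e2 e01 e02 e12.
  have cancel (x z : k) : z != 0 -> 0 = x * z -> x = 0.
    by move=> z0 xz; apply: (mulIf z0); rewrite mul0r.
  have [l00|l00] := eqVneq l0 0; last first.
    have b00 : b0 = 0 by apply: cancel l00 e0.
    split=> //; apply: (cancel _ _ l00).
      by rewrite e01 b00 mul0r add0r.
    by rewrite e02 b00 mul0r add0r.
  have [l10|l10] := eqVneq l1 0; last first.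
    have b10 : b1 = 0 by apply: cancel l10 e1.
    split=> //; apply: (cancel _ _ l10).
      by rewrite e01 b10 mul0r addr0.
    by rewrite e12 b10 mul0r add0r.
  have [l20|l20] := eqVneq l2 0; first by case: nl.
  have b20 : b2 = 0 by apply: cancel l20 e2.
  split=> //; apply: (cancel _ _ l20).
    by rewrite e02 b20 mul0r addr0.
  by rewrite e12 b20 mul0r addr0.
exact: (tgrad_nnull two_neq0 dc ny).
Qed.

(** Each line pulls back under projection from [y] to a nonzero polynomial in the direction, and the
    product of these is nonzero somewhere on [k]-points. *)
Lemma ex_conic_point (k : fieldType) (k_inf : infinite_field k)
    (two_neq0 : (2 : k) != 0) (c : tform k) (y : tvec k) (ls : seq (tvec k)) :
  tdisc c != 0 -> ~ tnull y -> teval c y = 0 -> (forall l, List.In l ls -> ~ tnull l) ->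
  exists z, teval c z = 0 /\ forall l, List.In l ls -> tdot l z != 0.
Proof.
move=> dc ny cy nls.
pose D (v : 'I_3 -> k) := TVec (v 0) (v 1) (v 2).
suff [h h0 hls] : exists2 h : {mpoly k[3]}, h != 0 & forall v, h.@[v] != 0 ->
    forall l, List.In l ls -> tdot l (tproj c y (D v)) != 0.
  have [v hv] := ex_meval_neq0 k_inf h0.
  by exists (tproj c y (D v)); split; [apply: teval_proj | apply: hls].
elim: ls nls => [|l ls IH] nls.
  by exists 1; rewrite ?oner_neq0.
have [|h h0 hls] := IH; first by move=> m ml; apply: nls; right.
have [f hf] : polyfun (fun v => tdot l (tproj c y (D v))).
  rewrite /tdot /= /teval /tdot /=.
  by do ![exact: polyfun_const | exact: polyfun_coord | apply: polyfunD
    | apply: polyfunN | apply: polyfunM | apply: polyfunX].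
exists (f * h) => [|v].
  rewrite mulf_neq0 //; apply/eqP => f0.
  apply: (tproj_not_in_line two_neq0 dc ny (nls l (or_introl erefl))) => -[d0 d1 d2].
  have := hf (fun i => tnth [tuple d0; d1; d2] i).
  by rewrite f0 meval0 => <-.
rewrite mevalM hf mulf_eq0 negb_or => /andP[fv hv] m [<-//|]; exact: hls.
Qed.

(** * The quartic surface *)

(** Coefficients live in the ring of the variables, so that a form over [k] can be evaluated in any
    ring through a map. *)
Definition bform (R : pzSemiRingType) (d : nat) (c : 'I_d.+1 -> R) (x0 x1 : R) : R :=
  \sum_(e < d.+1) c e * (x0 ^+ (d - e) * x1 ^+ e).

Definition fibre (k : fieldType) (R : comPzRingType) (f : k -> R)
    (Q : conic_bundle k) (x0 x1 : R) : tform R :=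
  TForm (bform (fun e => f (sigma00 Q 0 e)) x0 x1)
        (bform (fun e => f (sigma01 Q 0 e)) x0 x1)
        (bform (fun e => f (sigma02 Q 0 e)) x0 x1)
        (bform (fun e => f (sigma11 Q 0 e)) x0 x1)
        (bform (fun e => f (sigma12 Q 0 e)) x0 x1)
        (bform (fun e => f (sigma22 Q 0 e)) x0 x1).

Lemma conic_fibre (k K : fieldType) (iota : {rmorphism k -> K})
    (Q : conic_bundle k) (w : 'I_5 -> K) :
  (map_mpoly iota (conic_eq Q)).@[w] =
  teval (fibre iota Q (w ix0) (w ix1)) (TVec (w iy0) (w iy1) (w iy2)).
Proof. by rewrite conic_evalE. Qed.

(** The chart y_0 = 1: [phi] sends (z_0, z_1, 1, z_2, z_3) to [z], so the quartic at [z] is the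
    conic over (z_0 : z_1) evaluated there. *)
Definition quartic_at (k : fieldType) (Q : conic_bundle k) (z : 'rV[k]_4) : k :=
  teval (fibre id Q (z 0 iz0) (z 0 iz1)) (TVec 1 (z 0 iz2) (z 0 iz3)).

Lemma meval_quartic (k : fieldType) (Q : conic_bundle k) (z : 'rV[k]_4) :
  (quartic Q).@[fun i => z 0 i] = quartic_at Q z.
Proof.
have -> : quartic Q = map_mpoly idfun (quartic Q).
  by apply/mpolyP => m; rewrite mcoeff_map_mpoly.
by rewrite quartic_evalE /quartic_at /teval /= !expr1n !mulr1.
Qed.

Lemma mderivXn (R : comNzRingType) (n : nat) (i : 'I_n) (p : {mpoly R[n]}) m :
  (p ^+ m)^`M(i) = m%:R * p ^+ m.-1 * p^`M(i).
Proof.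
elim: m => [|m IH]; first by rewrite expr0 mul0r mul0r -mpolyC1 mderivC.
rewrite exprS mderivM IH; case: m {IH} => [|m]; first by rewrite !expr0; ring.
by rewrite /= -[m.+2%:R]natr1 exprS; ring.
Qed.

Lemma mderivXU (R : comNzRingType) (n : nat) (i j : 'I_n) :
  ('X_j : {mpoly R[n]})^`M(i) = (j == i)%:R.
Proof.
rewrite mderivX mnm1E; case: eqP => [->|_]; last by rewrite scale0r.
rewrite scale1r -mpolyX0; congr 'X_[_].
by apply/mnmP => l; rewrite mnmBE mnm0E subnn.
Qed.

Lemma meval_mderiv_binary_form (k : fieldType) (n d : nat) (c : 'rV[k]_d.+1)
    (i a b : 'I_n) (w : 'I_n -> k) :
  (binary_form c ('X_a : {mpoly k[n]}) 'X_b)^`M(i).@[w] =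
  \sum_(e < d.+1) c 0 e *
    ((d - e)%:R * w a ^+ (d - e).-1 * (a == i)%:R * w b ^+ e
     + w a ^+ (d - e) * (e%:R * w b ^+ e.-1 * (b == i)%:R)).
Proof.
rewrite /binary_form (raddf_sum (mderiv i)) (rmorph_sum (meval w)) /=.
apply: eq_bigr => e _; rewrite mderivZ mevalZ mderivM !mderivXn !mderivXU.
by rewrite mevalD !mevalM !rmorphXn /= !rmorph_nat !mevalXU.
Qed.

Definition dquartic (k : fieldType) (Q : conic_bundle k) (z t : 'rV[k]_4) : k :=
  \sum_i gradient (quartic Q) z 0 i * t 0 i.

(** The part of the partial derivative that falls on the forms sigma, with z_2 and z_3 held
    fixed. *)
Definition tderiv (k : fieldType) (Q : conic_bundle k) (z : 'rV[k]_4) (i : 'I_4) :=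
  let s d (c : 'rV[k]_d.+1) := (binary_form c ('X_iz0 : {mpoly k[4]}) 'X_iz1)^`M(i)
    .@[fun i => z 0 i] in
  teval (TForm (s _ (sigma00 Q)) (s _ (sigma01 Q)) (s _ (sigma02 Q))
    (s _ (sigma11 Q)) (s _ (sigma12 Q)) (s _ (sigma22 Q))) (TVec 1 (z 0 iz2) (z 0 iz3)).

Lemma gradientE (k : fieldType) (Q : conic_bundle k) (z : 'rV[k]_4) (i : 'I_4) :
  gradient (quartic Q) z 0 i =
  tderiv Q z i
  + tdot (tgrad (fibre id Q (z 0 iz0) (z 0 iz1)) (TVec 1 (z 0 iz2) (z 0 iz3)))
         (TVec 0 (iz2 == i)%:R (iz3 == i)%:R).
Proof.
have bE d (c : 'rV[k]_d.+1) :
    (binary_form c ('X_iz0 : {mpoly k[4]}) 'X_iz1).@[fun i => z 0 i] =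
    bform (fun e => c 0 e) (z 0 iz0) (z 0 iz1).
  rewrite /binary_form (rmorph_sum (meval _)) /=; apply: eq_bigr => e _.
  by rewrite mevalZ mevalM !rmorphXn /= !mevalXU.
rewrite mxE /quartic !expr2 !mderivD !mderivM !mderivXU /tderiv /tdot /=.
rewrite !(mevalD, mevalM, rmorph_nat, mevalXU, bE) /teval /=.
do 6!move: (_^`M(i)).@[_] => ?.
by ring.
Qed.

(** Derivative of [bform] in the direction (t0, t1); a truncated predecessor at exponent 0 is
    multiplied by 0. *)
Definition dbform (R : pzRingType) (d : nat) (c : 'I_d.+1 -> R) (x0 x1 t0 t1 : R) : R :=
  \sum_(e < d.+1) c e *
    ((d - e)%:R * x0 ^+ (d - e).-1 * t0 * x1 ^+ e
     + x0 ^+ (d - e) * (e%:R * x1 ^+ e.-1 * t1)).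

Lemma dbform_lin (R : comPzRingType) (d : nat) (c : 'I_d.+1 -> R) (x0 x1 t0 t1 : R) :
  dbform c x0 x1 t0 t1 = dbform c x0 x1 1 0 * t0 + dbform c x0 x1 0 1 * t1.
Proof.
rewrite /dbform !mulr_suml -big_split; apply: eq_bigr => e _ /=.
by ring.
Qed.

Definition dfibre (k : fieldType) (Q : conic_bundle k) (x0 x1 t0 t1 : k) : tform k :=
  TForm (dbform (sigma00 Q 0) x0 x1 t0 t1) (dbform (sigma01 Q 0) x0 x1 t0 t1)
        (dbform (sigma02 Q 0) x0 x1 t0 t1) (dbform (sigma11 Q 0) x0 x1 t0 t1)
        (dbform (sigma12 Q 0) x0 x1 t0 t1) (dbform (sigma22 Q 0) x0 x1 t0 t1).

Lemma tderivE (k : fieldType) (Q : conic_bundle k) (z : 'rV[k]_4) (i : 'I_4) :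
  tderiv Q z i = teval (dfibre Q (z 0 iz0) (z 0 iz1) (iz0 == i)%:R (iz1 == i)%:R)
    (TVec 1 (z 0 iz2) (z 0 iz3)).
Proof. by rewrite /tderiv !meval_mderiv_binary_form. Qed.

Lemma dfibre0 (k : fieldType) (Q : conic_bundle k) (x0 x1 : k) y :
  teval (dfibre Q x0 x1 0 0) y = 0.
Proof.
have h d (c : 'I_d.+1 -> k) : dbform c x0 x1 0 0 = 0.
  by rewrite dbform_lin !mulr0 addr0.
by rewrite /teval /= !h !mul0r !addr0.
Qed.

Lemma dquarticE (k : fieldType) (Q : conic_bundle k) (z t : 'rV[k]_4) :
  dquartic Q z t =
  teval (dfibre Q (z 0 iz0) (z 0 iz1) (t 0 iz0) (t 0 iz1)) (TVec 1 (z 0 iz2) (z 0 iz3))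
  + tdot (tgrad (fibre id Q (z 0 iz0) (z 0 iz1)) (TVec 1 (z 0 iz2) (z 0 iz3)))
         (TVec 0 (t 0 iz2) (t 0 iz3)).
Proof.
rewrite /dquartic !big_ord_recl !big_ord0 !gradientE !tderivE.
have -> : lift (ord0 : 'I_4) (ord0 : 'I_3) = iz1 by apply: val_inj.
have -> : lift (ord0 : 'I_4) (lift (ord0 : 'I_3) (ord0 : 'I_2)) = iz2.
  by apply: val_inj.
have -> : lift (ord0 : 'I_4) (lift (ord0 : 'I_3) (lift (ord0 : 'I_2) (ord0 : 'I_1)))
    = iz3 by apply: val_inj.
have -> : (ord0 : 'I_4) = iz0 by apply: val_inj.
rewrite /= !dfibre0.
set g := tgrad _ _; case: g => g0 g1 g2.
rewrite [teval (dfibre _ _ _ (t _ _) _) _]/teval /=.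
rewrite [dbform _ _ _ (t _ _) _]dbform_lin.
rewrite [dbform (sigma01 _ _) _ _ (t _ _) _]dbform_lin.
rewrite [dbform (sigma02 _ _) _ _ (t _ _) _]dbform_lin.
rewrite [dbform (sigma11 _ _) _ _ (t _ _) _]dbform_lin.
rewrite [dbform (sigma12 _ _) _ _ (t _ _) _]dbform_lin.
rewrite [dbform (sigma22 _ _) _ _ (t _ _) _]dbform_lin.
rewrite /tdot /teval /=.
do 12!move: (dbform _ _ _ _ _) => ?.
move: (z 0 iz2) (z 0 iz3) (t 0 iz0) (t 0 iz1) (t 0 iz2) (t 0 iz3) => *.
by ring.
Qed.

(* The expansion on the line through P and R of a quartic form with values p, r, s
   at P, R, P + R and derivatives dp at P towards R, dr at R towards P. *)
Definition taylor4 (R : pzRingType) (u v : R) (f p r s dp dr : R) : Prop :=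
  f = u ^+ 4 * p + u ^+ 3 * v * dp + u * v ^+ 3 * dr + v ^+ 4 * r
      + u ^+ 2 * v ^+ 2 * (s - p - dp - dr - r).

Lemma taylor4D (R : comPzRingType) (u v f p r s dp dr f' p' r' s' dp' dr' : R) :
  taylor4 u v f p r s dp dr -> taylor4 u v f' p' r' s' dp' dr' ->
  taylor4 u v (f + f') (p + p') (r + r') (s + s') (dp + dp') (dr + dr').
Proof. by rewrite /taylor4 => -> ->; ring. Qed.

(** The expansion is linear in the coefficients of the form, so it need only be checked on each
    monomial times the cofactor [f]. *)
Lemma taylor4_bform (R : comPzRingType) (u v : R) (d : nat) (c : 'I_d.+1 -> R)
    (p0 p1 r0 r1 f p r s dp dr : R) :
  (forall e, (e <= d)%N ->
    let m x0 x1 := x0 ^+ (d - e) * x1 ^+ e in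
    let dm x0 x1 t0 t1 := (d - e)%:R * x0 ^+ (d - e).-1 * t0 * x1 ^+ e
      + x0 ^+ (d - e) * (e%:R * x1 ^+ e.-1 * t1) in
    taylor4 u v (m (u * p0 + v * r0) (u * p1 + v * r1) * f)
      (m p0 p1 * p) (m r0 r1 * r) (m (p0 + r0) (p1 + r1) * s)
      (dm p0 p1 r0 r1 * p + m p0 p1 * dp) (dm r0 r1 p0 p1 * r + m r0 r1 * dr)) ->
  taylor4 u v (bform c (u * p0 + v * r0) (u * p1 + v * r1) * f)
    (bform c p0 p1 * p) (bform c r0 r1 * r) (bform c (p0 + r0) (p1 + r1) * s)
    (dbform c p0 p1 r0 r1 * p + bform c p0 p1 * dp)
    (dbform c r0 r1 p0 p1 * r + bform c r0 r1 * dr).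
Proof.
move=> hm; rewrite /taylor4 /bform /dbform !mulr_suml -!big_split /=.
rewrite !mulr_sumr -!sumrB !mulr_sumr -!big_split /=; apply: eq_bigr => -[e /= he] _.
have := hm e he; rewrite /taylor4 /= -!mulrA => ->.
by ring.
Qed.

Lemma quartic_line (k : fieldType) (Q : conic_bundle k) (P R : 'rV[k]_4) (u v : k) :
  taylor4 u v (quartic_at Q (u *: P + v *: R)) (quartic_at Q P) (quartic_at Q R)
    (quartic_at Q (P + R)) (dquartic Q P R) (dquartic Q R P).
Proof.
rewrite !dquarticE /quartic_at !mxE.
move: (P 0 iz0) (P 0 iz1) (P 0 iz2) (P 0 iz3) => p0 p1 p2 p3.
move: (R 0 iz0) (R 0 iz1) (R 0 iz2) (R 0 iz3) => r0 r1 r2 r3.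
rewrite /teval /tdot /tgrad /=.
set s00 := sigma00 Q 0; set s01 := sigma01 Q 0; set s02 := sigma02 Q 0.
set s11 := sigma11 Q 0; set s12 := sigma12 Q 0; set s22 := sigma22 Q 0.
(* The arguments after the points describe the cofactor of each form in z_2, z_3: its values at the
   running point, [P], [R] and [P + R], then its derivatives at [P] and at [R]. *)
have T (c : 'I_5 -> k) := @taylor4_bform _ u v 4 c p0 p1 r0 r1 1 1 1 1 0 0.
have T1 (c : 'I_4 -> k) := @taylor4_bform _ u v 3 c p0 p1 r0 r1
  (u * p2 + v * r2) p2 r2 (p2 + r2) r2 p2.
have T2 (c : 'I_4 -> k) := @taylor4_bform _ u v 3 c p0 p1 r0 r1
  (u * p3 + v * r3) p3 r3 (p3 + r3) r3 p3.
have T3 (c : 'I_3 -> k) := @taylor4_bform _ u v 2 c p0 p1 r0 r1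
  ((u * p2 + v * r2) ^+ 2) (p2 ^+ 2) (r2 ^+ 2) ((p2 + r2) ^+ 2)
  (2 * p2 * r2) (2 * r2 * p2).
have T4 (c : 'I_3 -> k) := @taylor4_bform _ u v 2 c p0 p1 r0 r1
  ((u * p2 + v * r2) * (u * p3 + v * r3)) (p2 * p3) (r2 * r3)
  ((p2 + r2) * (p3 + r3)) (p2 * r3 + p3 * r2) (r2 * p3 + r3 * p2).
have T5 (c : 'I_3 -> k) := @taylor4_bform _ u v 2 c p0 p1 r0 r1
  ((u * p3 + v * r3) ^+ 2) (p3 ^+ 2) (r3 ^+ 2) ((p3 + r3) ^+ 2)
  (2 * p3 * r3) (2 * r3 * p3).
have {}T := T s00 _; have {}T1 := T1 s01 _; have {}T2 := T2 s02 _.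
have {}T3 := T3 s11 _; have {}T4 := T4 s12 _; have {}T5 := T5 s22 _.
apply: (etrans _ (etrans (taylor4D (taylor4D (taylor4D (taylor4D (taylor4D
  (T _) (T1 _)) (T2 _)) (T3 _)) (T4 _)) (T5 _)) _)).
- by move=> {T T1 T2 T3 T4 T5}; do 6!move: (bform _ _ _) => ?; ring.
- by move=> {T T1 T2 T3 T4 T5} [|[|[|[|[|//]]]]] _ /=; rewrite /taylor4 ?subSS ?subn0; ring.
- by move=> {T T1 T2 T3 T4 T5} [|[|[|[|//]]]] _ /=; rewrite /taylor4 ?subSS ?subn0; ring.
- by move=> {T T1 T2 T3 T4 T5} [|[|[|[|//]]]] _ /=; rewrite /taylor4 ?subSS ?subn0; ring.
- by move=> {T T1 T2 T3 T4 T5} [|[|[|//]]] _ /=; rewrite /taylor4 ?subSS ?subn0; ring.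
- by move=> {T T1 T2 T3 T4 T5} [|[|[|//]]] _ /=; rewrite /taylor4 ?subSS ?subn0; ring.
- by move=> {T T1 T2 T3 T4 T5} [|[|[|//]]] _ /=; rewrite /taylor4 ?subSS ?subn0; ring.
by move=> {T T1 T2 T3 T4 T5}; do 12!move: (dbform _ _ _ _ _) => ?;
  do 18!move: (bform _ _ _) => ?; ring.
Qed.

(** * Polynomials in four variables and their specializations *)

Definition pev (R S : comNzRingType) (f : {rmorphism R -> S}) (x : S) :
    {rmorphism {poly R} -> S} :=
  horner_morph (fun a => mulrC x (f a)).

Lemma pevC (R S : comNzRingType) (f : {rmorphism R -> S}) x c : pev f x c%:P = f c.
Proof. exact: horner_morphC. Qed.

Lemma pevX (R S : comNzRingType) (f : {rmorphism R -> S}) x : pev f x 'X = x.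
Proof. exact: horner_morphX. Qed.

Definition ev4 (k K : comNzRingType) (f : {rmorphism k -> K}) (u v y z : K) :
    {rmorphism {poly {poly {poly {poly k}}}} -> K} :=
  pev (pev (pev (pev f u) v) y) z.

(** Infinitely many, without cardinals. When nested, the values excluded for a later variable may
    depend on the earlier ones. *)
Definition Inf (T : eqType) (P : T -> Prop) : Prop :=
  forall s : seq T, exists2 x, x \notin s & P x.

Lemma Inf_mono (T : eqType) (P Q : T -> Prop) :
  (forall x, P x -> Q x) -> Inf P -> Inf Q.
Proof. by move=> PQ iP s; have [x xs /PQ] := iP s; exists x. Qed.

Lemma Inf_pev0 (k : fieldType) (R : comNzRingType) (f : {rmorphism R -> k})
    (p : {poly R}) :
  Inf (fun x => pev f x p = 0) -> forall i, f p`_i = 0.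
Proof.
move=> ip i; rewrite -coef_map.
have [->|/all_roots[s hs]] := eqVneq (map_poly f p) 0; first by rewrite coef0.
have [x /negP xs px] := ip s; case: xs; apply: hs; exact/eqP.
Qed.

Lemma Inf4_eq0 (k : fieldType) (p : {poly {poly {poly {poly k}}}}) :
  Inf (fun u => Inf (fun v => Inf (fun y => Inf (fun z =>
    ev4 idfun u v y z p = 0)))) -> p = 0.
Proof.
move=> h; apply/polyP => i; rewrite coef0; apply/polyP => j; rewrite coef0.
apply/polyP => l; rewrite coef0; apply/polyP => m; rewrite coef0.
apply: (@Inf_pev0 _ _ idfun); apply: Inf_mono h => u h.
apply: Inf_pev0; apply: Inf_mono h => v h.
apply: Inf_pev0; apply: Inf_mono h => y h.
exact: Inf_pev0.
Qed.

Lemma pev_quadratic (R S : comNzRingType) (e : {rmorphism R -> S}) (a b c : R) (w : S) :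
  pev e w (a%:P * 'X^2 + (b%:P * 'X + c%:P)) = e a * w ^+ 2 + e b * w + e c.
Proof. by rewrite [in LHS]expr2 !rmorphD !rmorphM /= !pevC !pevX addrA. Qed.

Lemma pev_linear (R S : comNzRingType) (e : {rmorphism R -> S}) (b c : R) (w : S) :
  pev e w (b%:P * 'X + c%:P) = e b * w + e c.
Proof. by rewrite rmorphD rmorphM /= !pevC !pevX. Qed.

Definition two_common_roots (k : fieldType) (R : comNzRingType) (G : {poly R})
    (a b c : R) (e : {rmorphism R -> k}) : Prop :=
  exists w w', [/\ w != w', e a * w ^+ 2 + e b * w + e c = 0,
    e a * w' ^+ 2 + e b * w' + e c = 0, pev e w G = 0 & pev e w' G = 0].

(** Pseudo-division multiplies [G] by a power of [a], whence [e a != 0] in the conclusion. The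
    premise on [r] stands for the density of the specializations with two common roots: it makes the
    remainder zero in [R] itself, hence over every [K]. *)
Lemma vanish_at_roots (k : fieldType) (R : idomainType) (G : {poly R}) (a b c : R) :
  a != 0 ->
  (forall r : R, (forall e : {rmorphism R -> k}, two_common_roots G a b c e ->
    e r = 0) -> r = 0) ->
  forall (K : fieldType) (e : {rmorphism R -> K}) (w : K),
    e a != 0 -> e a * w ^+ 2 + e b * w + e c = 0 -> pev e w G = 0.
Proof.
move=> a0 sep; set q := a%:P * 'X^2 + (b%:P * 'X + c%:P).
have szbc : (size (b%:P * 'X + c%:P)%R < 3)%N
  by rewrite size_MXaddC size_polyC; case: ifP => //; case: (b != 0).
have szq : size q = 3%N.
  by rewrite /q mul_polyC size_polyDl size_scale ?size_polyXn.
have lq : lead_coef q = a.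
  rewrite /q mul_polyC lead_coefDl; first by rewrite lead_coefZ lead_coefXn mulr1.
  by rewrite size_scale // size_polyXn.
have q0 : q != 0 by rewrite -size_poly_eq0 szq.
have := Pdiv.Idomain.divp_eq G q; rewrite lq -mul_polyC; move: (scalp G q) => N.
set M := G %/ q; set r := G %% q => def_G.
have szr : (size r <= 2)%N by rewrite -ltnS -szq ltn_modp.
have def_r : r = (r`_1)%:P * 'X + (r`_0)%:P.
  apply/polyP => i; rewrite coefD coefMX !coefC.
  case: i => [|[|i]] /=; rewrite ?add0r ?addr0 //.
  by rewrite nth_default // (leq_trans szr).
have ev_G (S : comNzRingType) (e : {rmorphism R -> S}) w :
    e a * w ^+ 2 + e b * w + e c = 0 ->
    e a ^+ N * pev e w G = e r`_1 * w + e r`_0.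
  move=> qw; have := congr1 (pev e w) def_G.
  rewrite [in RHS]rmorphD [in LHS]rmorphM [in RHS]rmorphM pev_quadratic qw mulr0 add0r.
  by rewrite {1}def_r pev_linear pevC rmorphXn.
have r01 (e : {rmorphism R -> k}) : two_common_roots G a b c e -> e r`_1 = 0 /\ e r`_0 = 0.
  case=> w [w' [ww' qw qw' Gw Gw']].
  have := ev_G k e w' qw'; have := ev_G k e w qw; rewrite Gw Gw' mulr0 => h h'.
  have /eqP : e r`_1 * (w - w') = 0.
    by rewrite -[RHS](subrr 0) {1}h {1}h'; ring.
  rewrite mulf_eq0 subr_eq0 (negPf ww') orbF => /eqP r1.
  by move: h; rewrite r1 mul0r add0r.
have r1 : r`_1 = 0 by apply: sep => e /r01[].
have r0 : r`_0 = 0 by apply: sep => e /r01[].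
move=> K e w ea /ev_G/eqP; rewrite r1 r0 !rmorph0 mul0r addr0.
by rewrite mulf_eq0 expf_eq0 (negPf ea) andbF => /eqP.
Qed.

(** * Dominance *)

Definition cox_vec (R : Type) (x0 x1 : R) (y : tvec R) (i : 'I_5) : R :=
  tnth [tuple x0; x1; tx y; ty y; tz y] i.

Lemma rmorph_bform (R S : comNzRingType) (e : {rmorphism R -> S}) (d : nat)
    (c : 'I_d.+1 -> R) (x0 x1 : R) :
  e (bform c x0 x1) = bform (e \o c) (e x0) (e x1).
Proof.
by rewrite /bform rmorph_sum; apply: eq_bigr => i _; rewrite !rmorphM !rmorphXn.
Qed.

Definition tmap (R S : Type) (e : R -> S) (c : tform R) : tform S :=
  TForm (e (t00 c)) (e (t01 c)) (e (t02 c)) (e (t11 c)) (e (t12 c)) (e (t22 c)).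

Lemma eq_bform (R : pzSemiRingType) (d : nat) (c c' : 'I_d.+1 -> R) (x0 x1 : R) :
  c =1 c' -> bform c x0 x1 = bform c' x0 x1.
Proof. by move=> cc'; apply: eq_bigr => i _; rewrite cc'. Qed.

Lemma tmap_fibre (k : fieldType) (R S : comNzRingType) (f : {rmorphism k -> R})
    (e : {rmorphism R -> S}) (h : k -> S) (Q : conic_bundle k) (x0 x1 : R) :
  e \o f =1 h -> tmap e (fibre f Q x0 x1) = fibre h Q (e x0) (e x1).
Proof.
by move=> fh; rewrite /tmap /= !rmorph_bform; congr TForm;
  apply: eq_bform => i; apply: fh.
Qed.

Lemma Inf_infinite (k : fieldType) (k_inf : infinite_field k) (P : k -> Prop) :
  (forall x, x != 0 -> P x) -> Inf P.
Proof.
move=> hP s; have [x] := k_inf (0 :: s); rewrite inE negb_or => /andP[x0 xs].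
by exists x => //; apply: hP.
Qed.

Lemma In_cat (T : Type) (x : T) (s t : seq T) :
  List.In x (s ++ t) <-> List.In x s \/ List.In x t.
Proof. exact: (List.in_app_iff s t x). Qed.

Lemma In_map (T : eqType) (U : Type) (f : T -> U) (y : U) (s : seq T) :
  List.In y (map f s) <-> exists2 x, x \in s & y = f x.
Proof.
elim: s => [|a s IH] /=; first by split=> // -[].
split=> [[<-|/IH[x xs ->]]|[x]]; first by exists a; rewrite ?mem_head.
  by exists x; rewrite ?inE ?xs ?orbT.
by rewrite inE => /predU1P[->|xs] yE; [left | right; apply/IH; exists x].
Qed.

(** One [k]-point of the conic is chosen and the second root comes from Vieta. All conditions on
    that root are linear in the chosen point, so they only ask to avoid finitely many lines. *)
Lemma Inf_conic_points (k : fieldType) (k_inf : infinite_field k)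
    (two_neq0 : (2 : k) != 0) (c : tform k) (y0 : tvec k) (y : k) :
  tdisc c != 0 -> t22 c != 0 -> ~ tnull y0 -> teval c y0 = 0 -> y != 0 ->
  Inf (fun z => exists w w', [/\ w != w', teval c (TVec y z w) = 0,
    teval c (TVec y z w') = 0, tdot (tgrad c y0) (TVec y z w) != 0
    & tdot (tgrad c y0) (TVec y z w') != 0]).
Proof.
move=> dc c22 ny0 cy0 y_neq0 s.
have nb := tgrad_nnull two_neq0 dc ny0; set b := tgrad c y0 in nb *.
pose b' := TVec (tx b - tz b * t02 c / t22 c) (ty b - tz b * t12 c / t22 c) (- tz b).
have nb' : ~ tnull b'.
  move=> [] /= + + /eqP; rewrite oppr_eq0 => b0 b1 /eqP b2.
  by apply: nb; split=> //; move: b0 b1; rewrite b2 !mul0r !subr0.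
(* In order: the first coordinate can be rescaled to [y]; neither root is on the tangent at [y0],
   [b'] being the pullback of [b] under the exchange of the roots; the roots differ. The last lines
   keep the second coordinate out of [s]. *)
pose ls := [:: TVec 1 0 0; b; b'; TVec (t02 c / t22 c) (t12 c / t22 c) 2]
  ++ [seq TVec (- a) y 0 | a <- s].
have [|z [cz hz]] := @ex_conic_point k k_inf two_neq0 c y0 ls dc ny0 cy0.
  move=> l /In_cat[/=|/In_map[a _ ->] [_ /eqP]]; last by rewrite (negPf y_neq0).
  case=> [<- [/eqP]|[<-//|[<-//|[<- [_ _ /eqP]|//]]]] /=.
    by rewrite oner_eq0.
  by rewrite (negPf two_neq0).
have hz1 l : List.In l [:: TVec 1 0 0; b; b'; TVec (t02 c / t22 c) (t12 c / t22 c) 2] ->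
    tdot l z != 0.
  by move=> hl; apply: hz; apply/In_cat; left.
have hz2 a : a \in s -> tdot (TVec (- a) y 0) z != 0.
  by move=> sa; apply: hz; apply/In_cat; right; apply/In_map; exists a.
have x_neq0 : tx z != 0.
  by have := hz1 _ (or_introl erefl); rewrite /tdot /= mul1r !mul0r !addr0.
have bz := hz1 _ (or_intror (or_introl erefl)).
have bz' := hz1 _ (or_intror (or_intror (or_introl erefl))).
have dz := hz1 _ (or_intror (or_intror (or_intror (or_introl erefl)))).
pose m := y / tx z; have m0 : m != 0 by rewrite mulf_neq0 ?invr_eq0.
have myx : m * tx z = y by rewrite /m divfK.
exists (m * ty z).
  by apply/negP => /hz2/negP[]; rewrite -myx /tdot /=; apply/eqP; ring.
pose w' := - (t02 c * tx z + t12 c * ty z) / t22 c - tz z.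
have cz' : teval c (TVec (tx z) (ty z) w') = 0.
  by rewrite -cz /w' /teval /=; field.
exists (m * tz z), (m * w'); rewrite -myx.
have sc v : TVec (m * tx z) (m * ty z) (m * v) = tscale m (TVec (tx z) (ty z) v) by [].
rewrite !sc !teval_scale !tdot_scale cz' mulr0.
have zE : TVec (tx z) (ty z) (tz z) = z by case: (z).
rewrite zE cz mulr0; split=> //; try by rewrite mulf_neq0.
  rewrite (inj_eq (mulfI m0)) -subr_eq0; apply: contra_neq dz => <-.
  by rewrite /w' /tdot /=; field.
rewrite mulf_neq0 //; apply: contra_neq bz' => <-.
by rewrite /w' /b' /tdot /=; field.
Qed.

Definition specializes (k : fieldType) (R S : comNzRingType) (i : {rmorphism k -> R})
    (f : {rmorphism k -> S}) (U V Y Z : R) (u v y z : S) (e : {rmorphism R -> S}) :=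
  e \o i =1 f /\ [/\ e U = u, e V = v, e Y = y & e Z = z].

(** The iterated polynomial ring is hidden behind the two properties used later: it specializes to
    any values, and an element killed by infinitely many nested specializations is zero. *)
Lemma ex_generic_point (k : fieldType) :
  exists (R : idomainType) (i : {rmorphism k -> R}) (U V Y Z : R),
    (forall (S : comNzRingType) (f : {rmorphism k -> S}) u v y z,
      exists e, specializes i f U V Y Z u v y z e) /\
    (forall r : R,
      Inf (fun u => Inf (fun v => Inf (fun y => Inf (fun z =>
        forall e, specializes i idfun U V Y Z u v y z e -> e r = 0)))) -> r = 0).
Proof.
pose i : {rmorphism k -> {poly {poly {poly {poly k}}}}} :=
  polyC \o (polyC \o (polyC \o polyC)).
exists {poly {poly {poly {poly k}}}}, i, 'X%:P%:P%:P, 'X%:P%:P, 'X%:P, 'X.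
have sp (S : comNzRingType) (f : {rmorphism k -> S}) u v y z :
    specializes i f 'X%:P%:P%:P 'X%:P%:P 'X%:P 'X u v y z (ev4 f u v y z).
  split; first by move=> a; rewrite /= /ev4 !pevC.
  by rewrite /ev4; split; rewrite ?pevC pevX.
split=> [S f u v y z|r hr]; first by exists (ev4 f u v y z).
apply: Inf4_eq0; move: hr; apply: Inf_mono => u; apply: Inf_mono => v.
by apply: Inf_mono => y; apply: Inf_mono => z; apply.
Qed.

(** [U], [V] move the base, [Y], [Z] are the first two fibre coordinates, and the third is a root of
    a quadratic with leading coefficient [t22]. Vanishing is assumed only off the tangent at some
    [y], on the points reached by projection from [y]; [Inf_conic_points] finds enough of them. *)
Lemma vanish_fibrewise (k : fieldType) (k_inf : infinite_field k)
    (two_neq0 : (2 : k) != 0) (Q : conic_bundle k) (p0 p1 r0 r1 : k) (g : {mpoly k[5]}) :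
  Inf (fun u => Inf (fun v =>
    let x0 := p0 * u + r0 * v in let x1 := p1 * u + r1 * v in
    let c := fibre id Q x0 x1 in
    [/\ tdisc c != 0, t22 c != 0 & exists y, [/\ ~ tnull y, teval c y = 0 &
      forall z, teval c z = 0 -> tdot (tgrad c y) z != 0 ->
        g.@[cox_vec x0 x1 z] = 0]])) ->
  forall (K : fieldType) (f : {rmorphism k -> K}) (u v : K) (y : tvec K),
    let x0 := f p0 * u + f r0 * v in let x1 := f p1 * u + f r1 * v in
    let c := fibre f Q x0 x1 in
    t22 c != 0 -> teval c y = 0 -> (map_mpoly f g).@[cox_vec x0 x1 y] = 0.
Proof.
have [R [kc [U [V [Y [Z [ex_e sep]]]]]]] := ex_generic_point k.
pose X0 := kc p0 * U + kc r0 * V; pose X1 := kc p1 * U + kc r1 * V.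
pose G : {poly R} := mmap (polyC \o kc) (cox_vec X0%:P X1%:P (TVec Y%:P Z%:P 'X)) g.
pose C := fibre kc Q X0 X1.
have eX (S : comNzRingType) (f : {rmorphism k -> S}) u v y z e p r :
    specializes kc f U V Y Z u v y z e -> e (kc p * U + kc r * V) = f p * u + f r * v.
  case=> fE [eU eV _ _]; rewrite rmorphD !rmorphM eU eV.
  by have /= -> := fE p; have /= -> := fE r.
have eC (S : comNzRingType) (f : {rmorphism k -> S}) u v y z e :
    specializes kc f U V Y Z u v y z e ->
    tmap e C = fibre f Q (f p0 * u + f r0 * v) (f p1 * u + f r1 * v).
  by move=> se; rewrite (tmap_fibre _ _ _ se.1) !(eX _ _ _ _ _ _ _ _ _ se).
have eG (S : comNzRingType) (f : {rmorphism k -> S}) u v y z w e :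
    specializes kc f U V Y Z u v y z e ->
    pev e w G =
    mmap f (cox_vec (f p0 * u + f r0 * v) (f p1 * u + f r1 * v) (TVec y z w)) g.
  move=> se; rewrite /G rmorph_mmap -!(eX _ _ _ _ _ _ _ _ _ se).
  case: (se) => fE [_ _ eY eZ]; apply: eq_mmap => [a|i].
    by rewrite /= pevC; apply: fE.
  case: i => [[|[|[|[|[|//]]]]] ?]; rewrite /cox_vec /= !(tnth_nth 0) /=.
  - exact: pevC.
  - exact: pevC.
  - by rewrite pevC.
  - by rewrite pevC.
  exact: pevX.
pose a := t22 C; pose b := t02 C * Y + t12 C * Z.
pose c := t00 C * Y ^+ 2 + t01 C * Y * Z + t11 C * Z ^+ 2.
have eq_q (S : comNzRingType) (f : {rmorphism k -> S}) u v y z w e :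
    specializes kc f U V Y Z u v y z e ->
    e a * w ^+ 2 + e b * w + e c =
    teval (fibre f Q (f p0 * u + f r0 * v) (f p1 * u + f r1 * v)) (TVec y z w).
  move=> se; rewrite -(eC _ _ _ _ _ _ _ se); case: se => _ [_ _ <- <-].
  rewrite /a /b /c; case: (C) => c0 c1 c2 c3 c4 c5.
  by rewrite /tmap /teval /= !(rmorphD, rmorphM, rmorphXn); ring.
move=> H; have a0 : a != 0.
  have [u _ /(_ [::])[v _ [_ h _]]] := H [::].
  have [e se] := ex_e _ idfun u v 0 0.
  apply: contra_neq h => a0; have := congr1 (@t22 _) (eC _ _ _ _ _ _ _ se).
  by rewrite /= => <-; apply: (etrans (congr1 e a0) (rmorph0 e)).
have sepk r : (forall e : {rmorphism R -> k}, two_common_roots G a b c e -> e r = 0) ->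
    r = 0.
  move=> hr; apply: sep; apply: Inf_mono H => u; apply: Inf_mono => v.
  case=> dc c22 [y0 [ny0 cy0 hg]]; apply: (Inf_infinite k_inf) => y y_neq0.
  apply: Inf_mono (Inf_conic_points k_inf two_neq0 dc c22 ny0 cy0 y_neq0) => z.
  case=> w [w' [ww' cw cw' bw bw']] e se; apply: hr; exists w, w'.
  rewrite !(eq_q _ _ _ _ _ _ _ _ se) !(eG _ _ _ _ _ _ _ _ se); split=> //.
    exact: (hg (TVec y z w)).
  exact: (hg (TVec y z w')).
move=> K f u v [y z w] x0 x1 cf c22 cy; have [e se] := ex_e _ f u v y z.
rewrite meval_map_mpoly -(eG _ _ _ _ _ _ _ _ se).
apply: (vanish_at_roots a0 sepk); last by rewrite (eq_q _ _ _ _ _ _ _ _ se).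
by have := congr1 (@t22 _) (eC _ _ _ _ _ _ _ se) => /= ->.
Qed.

Definition swap_bundle (k : fieldType) (Q : conic_bundle k) : conic_bundle k :=
  ConicBundle (sigma00 Q) (sigma02 Q) (sigma01 Q) (sigma22 Q) (sigma12 Q) (sigma11 Q).

Definition swap_vec (R : Type) (y : tvec R) : tvec R := TVec (tx y) (tz y) (ty y).

Lemma teval_swap (k : fieldType) (R : comPzRingType) (f : k -> R)
    (Q : conic_bundle k) (x0 x1 : R) (y : tvec R) :
  teval (fibre f (swap_bundle Q) x0 x1) y = teval (fibre f Q x0 x1) (swap_vec y).
Proof. by rewrite /teval /=; ring. Qed.

Lemma tdisc_swap (k : fieldType) (R : comPzRingType) (f : k -> R)
    (Q : conic_bundle k) (x0 x1 : R) :
  tdisc (fibre f (swap_bundle Q) x0 x1) = tdisc (fibre f Q x0 x1).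
Proof. by rewrite /tdisc /=; ring. Qed.

(** Where [t22] vanishes the reduction in y_2 breaks down; exchanging y_1 and y_2 covers these
    fibres as long as [t11] survives. *)
Lemma vanish_everywhere (k : fieldType) (k_inf : infinite_field k)
    (two_neq0 : (2 : k) != 0) (Q : conic_bundle k) (p0 p1 r0 r1 : k) (g : {mpoly k[5]}) :
  Inf (fun u => Inf (fun v =>
    let x0 := p0 * u + r0 * v in let x1 := p1 * u + r1 * v in
    let c := fibre id Q x0 x1 in
    [/\ tdisc c != 0, t11 c != 0, t22 c != 0 & exists y, [/\ ~ tnull y, teval c y = 0 &
      forall z, teval c z = 0 -> tdot (tgrad c y) z != 0 ->
        g.@[cox_vec x0 x1 z] = 0]])) ->
  forall (K : fieldType) (f : {rmorphism k -> K}) (u v : K) (y : tvec K),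
    let x0 := f p0 * u + f r0 * v in let x1 := f p1 * u + f r1 * v in
    let c := fibre f Q x0 x1 in
    (t11 c != 0) || (t22 c != 0) -> teval c y = 0 ->
    (map_mpoly f g).@[cox_vec x0 x1 y] = 0.
Proof.
move=> H K f u v y x0 x1 c /orP[c11|c22] cy; last first.
  apply: (vanish_fibrewise k_inf two_neq0 _ c22 cy).
  by apply: Inf_mono H => a; apply: Inf_mono => b [? ? ? ?]; split.
pose sw i : {mpoly k[5]} := cox_vec 'X_ix0 'X_ix1 (TVec 'X_iy0 'X_iy2 'X_iy1) i.
have gsE (S : comNzRingType) (h : {rmorphism k -> S}) z0 z1 z :
    (map_mpoly h (mmap (@mpolyC 5 k) sw g)).@[cox_vec z0 z1 z] =
    (map_mpoly h g).@[cox_vec z0 z1 (swap_vec z)].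
  rewrite !meval_map_mpoly (rmorph_mmap _ _ (mmap h _)).
  apply: eq_mmap => [a|i] /=; first by rewrite mmapC.
  by case: i => [[|[|[|[|[|//]]]]] ?]; rewrite /sw /cox_vec !(tnth_nth 0) /=
    mmapX mmap1U !(tnth_nth 0).
have swK (S : Type) : involutive (@swap_vec S) by case.
rewrite -(swK _ y) -gsE.
have cy' : teval (fibre f (swap_bundle Q) x0 x1) (swap_vec y) = 0.
  by rewrite teval_swap swK.
apply: (@vanish_fibrewise k k_inf two_neq0 (swap_bundle Q) p0 p1 r0 r1 _ _ K f u v
  (swap_vec y) c11 cy').
apply: Inf_mono H => a; apply: Inf_mono => b [dc ? ? [y0 [ny0 cy0 hg]]].
split; rewrite ?tdisc_swap //; exists (swap_vec y0); split.
- by case=> *; apply: ny0.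
- by rewrite teval_swap swK.
move=> z; rewrite teval_swap => cz bz.
have idE z0 z1 z2 (h : {mpoly k[5]}) : h.@[cox_vec z0 z1 z2] =
  (map_mpoly idfun h).@[cox_vec z0 z1 z2] by rewrite meval_map_mpoly.
rewrite idE gsE -idE; apply: hg => //; apply: contra_neq bz => <-.
by rewrite /tdot /=; ring.
Qed.

Lemma tproj_onto_scaled (k : fieldType) (c : tform k) (y z : tvec k) :
  teval c y = 0 -> teval c z = 0 -> tdot (tgrad c y) z != 0 ->
  exists d m, tscale m (tproj c y d) = z.
Proof.
move=> cy cz b0; exists (TVec (tx y - tx z) (ty y - ty z) (tz y - tz z)).
exists (- tdot (tgrad c y) z)^-1; rewrite tproj_onto //.
by rewrite /tscale /= !mulKf ?oppr_eq0 //; case: (z).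
Qed.

Definition tpolyfun (k : fieldType) (n : nat) (X : ('I_n -> k) -> tvec k) : Prop :=
  [/\ polyfun (fun t => tx (X t)), polyfun (fun t => ty (X t))
    & polyfun (fun t => tz (X t))].

Ltac polyfun_tac :=
  do ![assumption | exact: polyfun_const | exact: polyfun_coord | apply: polyfunD
    | apply: polyfunN | apply: polyfunM | apply: polyfunX].

Lemma polyfun_bform (k : fieldType) (n d : nat) (c : 'I_d.+1 -> k)
    (x0 x1 : ('I_n -> k) -> k) :
  polyfun x0 -> polyfun x1 -> polyfun (fun t => bform c (x0 t) (x1 t)).
Proof. by move=> h0 h1; apply: polyfun_sum => e; polyfun_tac. Qed.

Lemma tpolyfun_proj (k : fieldType) (n : nat) (c : ('I_n -> k) -> tform k)
    (y d : ('I_n -> k) -> tvec k) (m : ('I_n -> k) -> k) :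
  [/\ polyfun (fun t => t00 (c t)), polyfun (fun t => t01 (c t))
    & polyfun (fun t => t02 (c t))] ->
  [/\ polyfun (fun t => t11 (c t)), polyfun (fun t => t12 (c t))
    & polyfun (fun t => t22 (c t))] ->
  tpolyfun y -> tpolyfun d -> polyfun m ->
  tpolyfun (fun t => tscale (m t) (tproj (c t) (y t) (d t))).
Proof.
move=> [? ? ?] [? ? ?] [? ? ?] [? ? ?] ?.
by split; rewrite /= /teval /tdot /=; polyfun_tac.
Qed.

(** Two projections are composed: [base] from its point [xi], then each fibre from the value of the
    section [Y]. The last hypothesis confines the bad fibres for each [u] to a finite list, so that
    enough [k]-points of the image remain to test vanishing. *)
Lemma unirational_of_sections (k : fieldType) (k_inf : infinite_field k)
    (two_neq0 : (2 : k) != 0) (Q : conic_bundle k) (p0 p1 r0 r1 : k)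
    (base : tform k) (xi : tvec k) (Y : tvec k -> tvec k) :
  let fib X := fibre id Q (p0 * tx X + r0 * ty X) (p1 * tx X + r1 * ty X) in
  p0 * r1 - p1 * r0 != 0 ->
  (forall (K : fieldType) (f : {rmorphism k -> K}) u v, (u != 0) || (v != 0) ->
    let c := fibre f Q (f p0 * u + f r0 * v) (f p1 * u + f r1 * v) in
    (t11 c != 0) || (t22 c != 0)) ->
  tdisc base != 0 -> ~ tnull xi -> teval base xi = 0 ->
  (forall n (X : ('I_n -> k) -> tvec k), tpolyfun X -> tpolyfun (fun t => Y (X t))) ->
  (forall X, teval base X = 0 -> teval (fib X) (Y X) = 0) ->
  (forall u, u != 0 -> exists s : seq k, forall v, v \notin s -> forall w,
     let c := fib (TVec u v w) in
     [/\ tdisc c != 0, t11 c != 0, t22 c != 0 & ~ tnull (Y (TVec u v w))]) ->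
  unirational Q.
Proof.
move=> fib det0 nz_fib dbase nxi bxi polyY onY good.
(* Eight parameters: a direction and a scale for each of the two projections. The scales make the
   map hit prescribed vectors and not only their classes. *)
pose D (t : 'I_8 -> k) := TVec (t (inord 0)) (t (inord 1)) (t (inord 2)).
pose E (t : 'I_8 -> k) := TVec (t (inord 4)) (t (inord 5)) (t (inord 6)).
pose X t := tscale (t (inord 3)) (tproj base xi (D t)).
pose Z t := tscale (t (inord 7)) (tproj (fib (X t)) (Y (X t)) (E t)).
pose F t := cox_vec (p0 * tx (X t) + r0 * ty (X t)) (p1 * tx (X t) + r1 * ty (X t))
  (Z t).
have polyX : tpolyfun X.
  apply: tpolyfun_proj; last exact: polyfun_coord;
  by split; rewrite /=; polyfun_tac.
have polyZ : tpolyfun Z.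
  have [? ? ?] := polyX; apply: tpolyfun_proj; last exact: polyfun_coord.
  - by split; apply: polyfun_bform; polyfun_tac.
  - by split; apply: polyfun_bform; polyfun_tac.
  - exact: polyY.
  by split; rewrite /=; polyfun_tac.
have [h hF] : exists h : 'I_5 -> {mpoly k[8]}, forall i t, (h i).@[t] = F t i.
  have [pX1 pX2 pX3] := polyX; have [pZ1 pZ2 pZ3] := polyZ.
  have [h0 e0] : polyfun (fun t => p0 * tx (X t) + r0 * ty (X t)) by polyfun_tac.
  have [h1 e1] : polyfun (fun t => p1 * tx (X t) + r1 * ty (X t)) by polyfun_tac.
  case: pZ1 pZ2 pZ3 => [h2 e2] [h3 e3] [h4 e4].
  exists (cox_vec h0 h1 (TVec h2 h3 h4)).
  move=> [[|[|[|[|[|//]]]]] ?] t.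
  - exact: e0.
  - exact: e1.
  - exact: e2.
  - exact: e3.
  exact: e4.
have F_onto x z : teval base x = 0 -> tdot (tgrad base xi) x != 0 ->
    teval (fib x) z = 0 -> tdot (tgrad (fib x) (Y x)) z != 0 ->
    exists t, F t = cox_vec (p0 * tx x + r0 * ty x) (p1 * tx x + r1 * ty x) z.
  move=> bx gx cz gz.
  have [[d0 d1 d2] [l xE]] := tproj_onto_scaled bxi bx gx.
  have [[e0 e1 e2] [m zE]] := tproj_onto_scaled (onY x bx) cz gz.
  pose t (i : 'I_8) := nth 0 [:: d0; d1; d2; l; e0; e1; e2; m] i.
  have tX : X t = x by rewrite /X /D /t !inordK.
  by exists t; rewrite /F /Z tX /E /t !inordK //= zE.
pose iota : {rmorphism k -> {fraction {mpoly k[8]}}} :=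
  @tofrac {mpoly k[8]} \o @mpolyC 8 k.
pose psi : 'rV[{fraction {mpoly k[8]}}]_5 := \row_i tofrac (h i).
(* As [k] is infinite, vanishing at the generic point [psi] amounts to vanishing at all [k]-values
   of the parametrization. *)
have vanishP g : vanishes_at iota g psi <-> forall t, g.@[F t] = 0.
  have hE : (map_mpoly iota g).@[fun i => psi 0 i] =
      tofrac (map_mpoly (@mpolyC 8 k) g).@[h].
    rewrite (rmorph_meval_map _ (@tofrac {mpoly k[8]})).
    by rewrite !meval_map_mpoly; apply: eq_mmap => // i; rewrite mxE.
  have tE t : ((map_mpoly (@mpolyC 8 k) g).@[h]).@[t] = g.@[F t].
    rewrite (rmorph_meval_map _ (meval t)) meval_map_mpoly.
    by apply: eq_mmap => [a|i] /=; rewrite ?mevalC ?hF.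
  rewrite /vanishes_at hE; split=> [/eqP|g0].
    by rewrite tofrac_eq0 => /eqP g0 t; rewrite -tE g0 meval0.
  apply/eqP; rewrite tofrac_eq0; apply/negPn/negP => /(ex_meval_neq0 k_inf)[t].
  by rewrite tE g0 eqxx.
(* Excluded values of [v] become lines in the plane of [base], which a [k]-point of this conic can
   avoid; rescaling then brings its first coordinate to [u]. *)
have base_pts u : u != 0 -> Inf (fun v => exists w,
    [/\ teval base (TVec u v w) = 0, tdot (tgrad base xi) (TVec u v w) != 0
      & [/\ tdisc (fib (TVec u v w)) != 0, t11 (fib (TVec u v w)) != 0,
          t22 (fib (TVec u v w)) != 0 & ~ tnull (Y (TVec u v w))]]).
  move=> u0 s; have [s1 hs1] := good u u0.
  pose ls := [:: TVec 1 0 0; tgrad base xi] ++ [seq TVec (- a) u 0 | a <- s ++ s1].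
  have [|x [bx hx]] := @ex_conic_point k k_inf two_neq0 base xi ls dbase nxi bxi.
    move=> l /In_cat[/=|/In_map[a _ ->] [_ /eqP]]; last by rewrite (negPf u0).
    case=> [<- [/eqP]|[<-|//]]; first by rewrite oner_eq0.
    exact: (tgrad_nnull two_neq0 dbase nxi).
  have x0 : tx x != 0.
    have := hx (TVec 1 0 0) (or_introl erefl).
    by rewrite /tdot /= mul1r !mul0r !addr0.
  have gx := hx _ (or_intror (or_introl erefl)).
  pose m := u / tx x; have m0 : m != 0 by rewrite mulf_neq0 ?invr_eq0.
  have mx : m * tx x = u by rewrite /m divfK.
  have vs a : a \in s ++ s1 -> m * ty x != a.
    move=> sa; have : tdot (TVec (- a) u 0) x != 0.
      by apply: hx; apply/In_cat; right; apply/In_map; exists a.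
    by apply: contra_neq => <-; rewrite -mx /tdot /=; ring.
  exists (m * ty x).
    by apply/negP => sv; have := vs (m * ty x); rewrite mem_cat sv eqxx => /(_ isT).
  exists (m * tz x).
  have [|hd h11 h22 hY] := hs1 (m * ty x) _ (m * tz x).
    by apply/negP => sv; have := vs (m * ty x); rewrite mem_cat sv orbT eqxx => /(_ isT).
  have eX : tscale m x = TVec u (m * ty x) (m * tz x) by rewrite /tscale mx.
  split=> //; first by rewrite -eX teval_scale bx mulr0.
  by rewrite -eX tdot_scale mulf_neq0.
(* A single value off the irrelevant locus shows that enough of the polynomials [h i] are nonzero
   for [psi] to be a Cox point. *)
have [x [z [bx gx cz gz [xx zx]]]] : exists x z, [/\ teval base x = 0,
    tdot (tgrad base xi) x != 0, teval (fib x) z = 0,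
    tdot (tgrad (fib x) (Y x)) z != 0 & tx x != 0 /\ tx z != 0].
  have [v _ [w [bx gx [dx _ x22 nY]]]] := base_pts 1 (oner_neq0 _) [::].
  have [z _ [w' [_ [_ cz _ gz _]]]] := Inf_conic_points k_inf two_neq0 dx x22 nY
    (onY _ bx) (oner_neq0 k) [::].
  by exists (TVec 1 v w), (TVec 1 z w'); split=> //; rewrite !oner_neq0.
exists 8%N, psi; split; first split.
- have [t Ft] := F_onto x z bx gx cz gz.
  have nz i : F t i != 0 -> psi 0 i != 0.
    move=> Fi; rewrite mxE tofrac_eq0; apply: contra_neq Fi => hi.
    by rewrite -hF hi meval0.
  apply/andP; split; apply/orP; last by left; apply: nz; rewrite Ft.
  have [x00|x00] := eqVneq (p0 * tx x + r0 * ty x) 0; last first.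
    by left; apply: nz; rewrite Ft.
  right; apply: nz; rewrite Ft /=; apply/negP => /eqP x10.
  have /eqP : (p0 * r1 - p1 * r0) * tx x = 0.
    have -> : (p0 * r1 - p1 * r0) * tx x =
      r1 * (p0 * tx x + r0 * ty x) - r0 * (p1 * tx x + r1 * ty x) by ring.
    rewrite x00; have /= -> : p1 * tx x + r1 * ty x = 0 := x10.
    by rewrite !mulr0 subr0.
  by rewrite mulf_eq0 (negPf det0) (negPf xx).
- apply/vanishP => t.
  have -> : (conic_eq Q).@[F t] = (map_mpoly idfun (conic_eq Q)).@[F t].
    by rewrite meval_map_mpoly.
  rewrite conic_fibre -[LHS]/(teval (fib (X t)) (TVec (tx (Z t)) (ty (Z t)) (tz (Z t)))).
  have -> : TVec (tx (Z t)) (ty (Z t)) (tz (Z t)) = Z t by [].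
  rewrite teval_scale teval_proj ?mulr0 // onY //.
  by rewrite teval_scale teval_proj ?mulr0.
move=> g _ /vanishP g0 K f P [/andP[Px _]].
rewrite /vanishes_at conic_fibre => cP.
(* Cramer's rule for the base coordinates of [P] in the basis (p0, p1), (r0, r1). *)
pose d := f (p0 * r1 - p1 * r0); have d0 : d != 0 by rewrite fmorph_eq0.
have dE : d = f p0 * f r1 - f p1 * f r0 by rewrite /d rmorphB !rmorphM.
pose u := (f r1 * P 0 ix0 - f r0 * P 0 ix1) / d.
pose v := (f p0 * P 0 ix1 - f p1 * P 0 ix0) / d.
have du : u * d = f r1 * P 0 ix0 - f r0 * P 0 ix1 by rewrite /u divfK.
have dv : v * d = f p0 * P 0 ix1 - f p1 * P 0 ix0 by rewrite /v divfK.
clearbody u v.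
have uv0 : P 0 ix0 = f p0 * u + f r0 * v.
  by apply: (mulIf d0); rewrite mulrDl -!mulrA du dv dE; ring.
have uv1 : P 0 ix1 = f p1 * u + f r1 * v.
  by apply: (mulIf d0); rewrite mulrDl -!mulrA du dv dE; ring.
have nuv : (u != 0) || (v != 0).
  apply: contraTT Px; rewrite !negb_or !negbK => /andP[/eqP u0 /eqP v0].
  by rewrite uv0 uv1 u0 v0 !mulr0 !addr0 eqxx.
have -> : (map_mpoly f g).@[fun i => P 0 i] = (map_mpoly f g).@[
    cox_vec (f p0 * u + f r0 * v) (f p1 * u + f r1 * v)
      (TVec (P 0 iy0) (P 0 iy1) (P 0 iy2))].
  apply: meval_eq => i; rewrite -uv0 -uv1.
  case: i => [[|[|[|[|[|//]]]]] ?]; rewrite /cox_vec (tnth_nth 0) /=;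
  by congr (P _ _); apply: val_inj.
rewrite uv0 uv1 in cP.
apply: (vanish_everywhere k_inf two_neq0 _ (nz_fib K f u v nuv) cP).
apply: (Inf_infinite k_inf) => u' u0'; apply: Inf_mono (base_pts u' u0') => v' [w].
case=> bX gX [dX X11 X22 nY]; split=> //; exists (Y (TVec u' v' w)); split=> //.
  exact: (onY (TVec u' v' w) bX).
move=> y cy gy; have [t Ft] := F_onto (TVec u' v' w) y bX gX cy gy.
by have := g0 t; rewrite Ft.
Qed.

(** * The bisection cut out by a bitangent plane *)

Lemma dquartic_diag (k : fieldType) (Q : conic_bundle k) (z : 'rV[k]_4) :
  dquartic Q z z = 4 * quartic_at Q z.
Proof.
have euler d (c : 'I_d.+1 -> k) x0 x1 : dbform c x0 x1 x0 x1 = d%:R * bform c x0 x1.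
  rewrite /dbform /bform mulr_sumr; apply: eq_bigr => -[e /= he] _.
  have -> : d%:R = (d - e)%:R + e%:R :> k by rewrite -natrD subnK.
  have h n (x : k) : n%:R * x ^+ n.-1 * x = n%:R * x ^+ n.
    by case: n => [|n]; rewrite ?mul0r //= -mulrA -exprSr.
  by rewrite (h (d - e)%N x0) h; ring.
rewrite dquarticE /quartic_at /dfibre !euler /teval /tdot /=.
do 6!move: (bform _ _ _) => ?; ring.
Qed.

Lemma bform2_line (R : comPzRingType) (c : 'I_3 -> R) (p0 p1 r0 r1 u v : R) :
  bform c (p0 * u + r0 * v) (p1 * u + r1 * v) =
  bform c p0 p1 * u ^+ 2
  + (bform c (p0 + r0) (p1 + r1) - bform c p0 p1 - bform c r0 r1) * u * v
  + bform c r0 r1 * v ^+ 2.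
Proof.
rewrite /bform !big_ord_recl !big_ord0 /=.
do 3!move: (c _) => ?; ring.
Qed.

(* Twice a binary cubic is determined over any ring by its values at (1, 0), (0, 1),
   (1, 1) and (1, -1). *)
Definition cubic_line (R : pzRingType) (f : R -> R -> R) : Prop :=
  forall u v, 2 * f u v = 2 * f 1 0 * u ^+ 3 + 2 * f 0 1 * v ^+ 3
    + u * v * (u * (f 1 1 - f 1 (-1) - 2 * f 0 1) + v * (f 1 1 + f 1 (-1) - 2 * f 1 0)).

Lemma cubic_lineD (R : comPzRingType) (f g : R -> R -> R) :
  cubic_line f -> cubic_line g -> cubic_line (fun u v => f u v + g u v).
Proof. by move=> hf hg u v; rewrite mulrDr hf hg; ring. Qed.

Lemma cubic_lineZ (R : comPzRingType) (a : R) (f : R -> R -> R) :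
  cubic_line f -> cubic_line (fun u v => a * f u v).
Proof. by move=> hf u v; rewrite mulrCA hf; ring. Qed.

Lemma cubic_line_bform3 (R : comPzRingType) (c : 'I_4 -> R) (p0 p1 r0 r1 : R) :
  cubic_line (fun u v => bform c (p0 * u + r0 * v) (p1 * u + r1 * v)).
Proof.
move=> u v; rewrite /bform !big_ord_recl !big_ord0 /=.
do 4!move: (c _) => ?; ring.
Qed.

Lemma cubic_line_bform2 (R : comPzRingType) (c : 'I_3 -> R) (p0 p1 p2 r0 r1 r2 : R) :
  cubic_line (fun u v =>
    bform c (p0 * u + r0 * v) (p1 * u + r1 * v) * (p2 * u + r2 * v)).
Proof.
move=> u v; rewrite !bform2_line.
do 3!move: (bform _ _ _) => ?; ring.
Qed.

Definition resultant2 (R : comPzRingType) (s0 s1 s2 t0 t1 t2 : R) : R :=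
  (s0 * t2 - s2 * t0) ^+ 2 - (s0 * t1 - s1 * t0) * (s1 * t2 - s2 * t1).

(** Eliminating u^2 and v^2 in turn gives A u + B v = 0 and B u + C v = 0 when u and v are nonzero,
    and the resultant is B^2 - A C. *)
Lemma resultant2_root (K : fieldType) (s0 s1 s2 t0 t1 t2 u v : K) :
  (u != 0) || (v != 0) ->
  s0 * u ^+ 2 + s1 * u * v + s2 * v ^+ 2 = 0 ->
  t0 * u ^+ 2 + t1 * u * v + t2 * v ^+ 2 = 0 ->
  resultant2 s0 s1 s2 t0 t1 t2 = 0.
Proof.
move=> uv s t; set r := resultant2 _ _ _ _ _ _.
set A := s0 * t1 - s1 * t0; set B := s0 * t2 - s2 * t0; set C := s1 * t2 - s2 * t1.
have e1 : v * (A * u + B * v) = 0.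
  have -> : v * (A * u + B * v) = s0 * (t0 * u ^+ 2 + t1 * u * v + t2 * v ^+ 2)
      - t0 * (s0 * u ^+ 2 + s1 * u * v + s2 * v ^+ 2) by rewrite /A /B; ring.
  by rewrite s t !mulr0 subr0.
have e2 : u * (B * u + C * v) = 0.
  have -> : u * (B * u + C * v) = t2 * (s0 * u ^+ 2 + s1 * u * v + s2 * v ^+ 2)
      - s2 * (t0 * u ^+ 2 + t1 * u * v + t2 * v ^+ 2) by rewrite /B /C; ring.
  by rewrite s t !mulr0 subr0.
have [u0|u0] := eqVneq u 0.
  move: uv; rewrite u0 eqxx /= => /(expf_neq0 2) v0.
  have s20 : s2 = 0 by apply: (mulIf v0); rewrite mul0r -[RHS]s u0; ring.
  have t20 : t2 = 0 by apply: (mulIf v0); rewrite mul0r -[RHS]t u0; ring.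
  by rewrite /r /resultant2 s20 t20; ring.
have [v0|v0] := eqVneq v 0.
  have {}u0 := expf_neq0 2 u0.
  have s00 : s0 = 0 by apply: (mulIf u0); rewrite mul0r -[RHS]s v0; ring.
  have t00 : t0 = 0 by apply: (mulIf u0); rewrite mul0r -[RHS]t v0; ring.
  by rewrite /r /resultant2 s00 t00; ring.
move/eqP: e1; rewrite mulf_eq0 (negPf v0) addr_eq0 => /eqP e1.
move/eqP: e2; rewrite mulf_eq0 (negPf u0) addr_eq0 => /eqP e2.
have /eqP : r * (u * v) = 0.
  have -> : r * (u * v) = (B * u) * (B * v) - (A * u) * (C * v).
    by rewrite /r /resultant2 -/A -/B -/C; ring.
  by rewrite e2 e1; ring.
by rewrite !mulf_eq0 (negPf u0) (negPf v0) !orbF => /eqP.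
Qed.

Lemma teval_comb (R : comPzRingType) (c : tform R) (a b : R) (y d : tvec R) :
  teval c (TVec (a * tx y + b * tx d) (a * ty y + b * ty d) (a * tz y + b * tz d)) =
  a ^+ 2 * teval c y + a * b * tdot (tgrad c y) d + b ^+ 2 * teval c d.
Proof. by rewrite /teval /tdot /=; ring. Qed.

Section BitangentLine.
Variables (k : fieldType) (Q : conic_bundle k) (P R : 'rV[k]_4).

Definition line_fibre (u v : k) : tform k :=
  fibre id Q (P 0 iz0 * u + R 0 iz0 * v) (P 0 iz1 * u + R 0 iz1 * v).

Definition line_point (u v : k) : tvec k :=
  TVec 1 (P 0 iz2 * u + R 0 iz2 * v) (P 0 iz3 * u + R 0 iz3 * v).

(** The point where the tangent plane at [P] meets the double line. With [line_point u v] it spans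
    the trace of the plane on the fibre over (u, v). *)
Definition tangent_dir : tvec k :=
  let g := tgrad (fibre id Q (P 0 iz0) (P 0 iz1)) (TVec 1 (P 0 iz2) (P 0 iz3)) in
  TVec 0 (tz g) (- ty g).

(** Quadratic in (u, v), since only sigma_11, sigma_12 and sigma_22 enter; its zeros are the fibres
    through that point of the double line. *)
Definition lineC (u v : k) : k := teval (line_fibre u v) tangent_dir.

Definition lineB (u v : k) : k :=
  tdot (tgrad (line_fibre u v) (line_point u v)) tangent_dir.

Definition lineM0 : k := lineB 1 1 - lineB 1 (-1).
Definition lineM1 : k := lineB 1 1 + lineB 1 (-1).
Definition lineA : k := quartic_at Q (P + R).

(* With (u, v) the coordinates of P^1 in which the fibres of P and R are (1, 0) and
   (0, 1), the tangent plane cuts the fibre over (u, v) in the roots of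
   lineA u^2 v^2 y^2 + lineB(u, v) y z + lineC(u, v) z^2, where
   2 lineB(u, v) = u v (lineM0 u + lineM1 v).  So the discriminant is u^2 v^2 times
   a quadratic form, and the bisection is the conic where that form is a square. *)
Definition bisection : tform k :=
  TForm (lineM0 ^+ 2 - 16 * lineA * lineC 1 0)
    (2 * lineM0 * lineM1 - 16 * lineA * (lineC 1 1 - lineC 1 0 - lineC 0 1)) 0
    (lineM1 ^+ 2 - 16 * lineA * lineC 0 1) 0 (- 1).

(** The quadratic formula with denominators cleared: z / y = u v (w - M) / (4 C), where M = [lineM0]
    u + [lineM1] v and u v w / 2 is the root of the discriminant. *)
Definition bisection_point (X : tvec k) : tvec k :=
  let C := lineC (tx X) (ty X) in let y := line_point (tx X) (ty X) in
  let b := tx X * ty X * (tz X - lineM0 * tx X - lineM1 * ty X) in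
  TVec (4 * C) (4 * C * ty y + b * ty tangent_dir)
    (4 * C * tz y + b * tz tangent_dir).

(** The resultant of sigma_11 and sigma_22 in the coordinates (u, v); the middle coefficients are
    read off at [P + R]. *)
Definition line_resultant : k :=
  let sP := fibre id Q (P 0 iz0) (P 0 iz1) in
  let sR := fibre id Q (R 0 iz0) (R 0 iz1) in
  let sPR := fibre id Q (P 0 iz0 + R 0 iz0) (P 0 iz1 + R 0 iz1) in
  resultant2 (t11 sP) (t11 sPR - t11 sP - t11 sR) (t11 sR)
             (t22 sP) (t22 sPR - t22 sP - t22 sR) (t22 sR).

Lemma lineC_expand u v :
  lineC u v = lineC 1 0 * u ^+ 2 + (lineC 1 1 - lineC 1 0 - lineC 0 1) * u * v
    + lineC 0 1 * v ^+ 2.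
Proof.
rewrite /lineC /line_fibre.
have -> : tangent_dir = TVec 0 (ty tangent_dir) (tz tangent_dir) by [].
move: (ty tangent_dir) (tz tangent_dir) => d1 d2; rewrite /teval /= !bform2_line.
do 9!move: (bform _ _ _) => ?.
by rewrite expr0n /=; ring.
Qed.

Lemma lineB_cubic : cubic_line lineB.
Proof.
have -> : lineB = fun u v : k => lineB u v by [].
rewrite /lineB /tdot.
have -> : tangent_dir = TVec 0 (ty tangent_dir) (tz tangent_dir) by [].
move: (ty tangent_dir) (tz tangent_dir) => d1 d2 u v /=.
set p0 := P 0 iz0; set p1 := P 0 iz1; set r0 := R 0 iz0; set r1 := R 0 iz1.
have h := cubic_lineD (cubic_lineD
   (cubic_lineD (cubic_lineZ d1 (cubic_line_bform3 (sigma01 Q 0) p0 p1 r0 r1))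
      (cubic_lineZ (2 * d1)
        (cubic_line_bform2 (sigma11 Q 0) p0 p1 (P 0 iz2) r0 r1 (R 0 iz2))))
   (cubic_lineZ d1 (cubic_line_bform2 (sigma12 Q 0) p0 p1 (P 0 iz3) r0 r1 (R 0 iz3))))
  (cubic_lineD
   (cubic_lineD (cubic_lineZ d2 (cubic_line_bform3 (sigma02 Q 0) p0 p1 r0 r1))
      (cubic_lineZ d2 (cubic_line_bform2 (sigma12 Q 0) p0 p1 (P 0 iz2) r0 r1 (R 0 iz2))))
   (cubic_lineZ (2 * d2)
      (cubic_line_bform2 (sigma22 Q 0) p0 p1 (P 0 iz3) r0 r1 (R 0 iz3)))).
have {h} := h u v; cbv beta; rewrite -/p0 -/p1 -/r0 -/r1.
do 5!move: (bform (sigma01 Q 0) _ _) => ?.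
do 5!move: (bform (sigma02 Q 0) _ _) => ?.
do 5!move: (bform (sigma11 Q 0) _ _) => ?.
do 5!move: (bform (sigma12 Q 0) _ _) => ?.
do 5!move: (bform (sigma22 Q 0) _ _) => ?.
move: (bform (sigma00 Q 0)) => ? h.
apply: (etrans _ (etrans h _)); ring.
Qed.

Hypotheses (FP : quartic_at Q P = 0) (FR : quartic_at Q R = 0).
Hypotheses (dPR : dquartic Q P R = 0) (dRP : dquartic Q R P = 0).
Hypothesis B01 : lineB 0 1 = 0.

(** Tangency at both ends kills the four outer coefficients of the quartic on the line and leaves
    the middle one. *)
Lemma line_point_eval u v :
  teval (line_fibre u v) (line_point u v) = lineA * u ^+ 2 * v ^+ 2.
Proof.
have := quartic_line Q P R u v; rewrite FP FR dPR dRP /taylor4 /lineA.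
rewrite {1}/quartic_at /line_fibre /line_point !mxE ![_ * u]mulrC ![_ * v]mulrC => ->.
by ring.
Qed.

(** The cubic [lineB] vanishes at (1, 0) because [tangent_dir] is tangent to the fibre at [P], and
    at (0, 1) by [B01], the same condition at [R]. *)
Lemma lineBE u v : 2 * lineB u v = u * v * (lineM0 * u + lineM1 * v).
Proof.
have B10 : lineB 1 0 = 0.
  rewrite /lineB /line_fibre /line_point !mulr1 !mulr0 !addr0 /tdot /tangent_dir.
  by case: (tgrad _ _) => g0 g1 g2 /=; ring.
by rewrite lineB_cubic B10 B01 /lineM0 /lineM1; ring.
Qed.

Lemma bisection_point_on X :
  teval bisection X = 0 -> teval (line_fibre (tx X) (ty X)) (bisection_point X) = 0.
Proof.
case: X => u v w /=; rewrite /bisection_point /=.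
set C := lineC u v; set b := u * v * _; move=> Xb.
have := teval_comb (line_fibre u v) (4 * C) b (line_point u v) tangent_dir.
rewrite [tx _]/= mulr1 [tx tangent_dir]/= mulr0 addr0 => ->.
rewrite -/(lineC u v) -/(lineB u v) -/C.
rewrite line_point_eval.
have -> : 4 * C * b * lineB u v = 2 * C * b * (2 * lineB u v) by ring.
(* At the chosen point the equation of the fibre is this cofactor times the equation of the
   bisection. *)
rewrite lineBE -(mulr0 (- (C * u ^+ 2 * v ^+ 2))) -[X in _ = _ * X]Xb /b.
have CE := lineC_expand u v; rewrite -/C in CE.
rewrite /teval /=; move: (lineC 1 0) (lineC 1 1) (lineC 0 1) CE => c0 c1 c2 CE.
set D := (X in _ = X); have -> : D = - (C * u ^+ 2 * v ^+ 2) *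
    ((lineM0 * u + lineM1 * v) ^+ 2
     - 16 * lineA * (c0 * u ^+ 2 + (c1 - c0 - c2) * u * v + c2 * v ^+ 2) - w ^+ 2).
  by rewrite /D; ring.
by rewrite -CE; ring.
Qed.

End BitangentLine.

Lemma C1_conic_point (k : fieldType) (k_C1 : C1_field k) (c : tform k) :
  exists y, ~ tnull y /\ teval c y = 0.
Proof.
pose X i : {mpoly k[3]} := 'X_(inord i).
pose f : {mpoly k[3]} := t00 c *: (X 0 * X 0) + t01 c *: (X 0 * X 1)
  + t02 c *: (X 0 * X 2) + t11 c *: (X 1 * X 1) + t12 c *: (X 1 * X 2)
  + t22 c *: (X 2 * X 2).
have hX i : X i \is 1.-homog by rewrite dhomogX /= mdeg1.
have homf : f \is 2.-homog by rewrite !rpredD // rpredZ // (dhomogM (hX _) (hX _)).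
have [v [[i vi] fv]] := k_C1 2%N 3%N f isT isT homf.
exists (TVec (v (inord 0)) (v (inord 1)) (v (inord 2))); split.
  case=> /= v0 v1 v2; case/eqP: vi; rewrite -[i]inord_val.
  by case: i => [[|[|[|//]]] ?] /=; rewrite ?v0 ?v1 ?v2.
rewrite -[RHS]fv /f !mevalD !mevalZ !mevalM !mevalXU /teval /=.
by ring.
Qed.

Lemma bform_scale (R : comPzRingType) (d : nat) (c : 'I_d.+1 -> R) (a x0 x1 : R) :
  bform c (a * x0) (a * x1) = a ^+ d * bform c x0 x1.
Proof.
rewrite /bform mulr_sumr; apply: eq_bigr => e _ /=.
have -> : a ^+ d = a ^+ (d - e) * a ^+ e by rewrite -exprD subnK // -ltnS.
by rewrite !exprMn; ring.
Qed.

Lemma tdisc_map (R S : comNzRingType) (e : {rmorphism R -> S}) (c : tform R) :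
  e (tdisc c) = tdisc (tmap e c).
Proof.
by rewrite /tdisc /= !(rmorph_nat, rmorphB, rmorphD, rmorphM, rmorphXn).
Qed.

Lemma teval_map (R S : comNzRingType) (e : {rmorphism R -> S}) (c : tform R)
    (y : tvec R) :
  e (teval c y) = teval (tmap e c) (TVec (e (tx y)) (e (ty y)) (e (tz y))).
Proof. by rewrite /teval /= !(rmorphD, rmorphM, rmorphXn). Qed.

(** * Unirationality under explicit genericity conditions *)

Section UnirationalLine.
Variables (k : fieldType) (Q : conic_bundle k) (P R : 'rV[k]_4).
Hypotheses (k_inf : infinite_field k) (k_C1 : C1_field k) (two_neq0 : (2 : k) != 0).
Hypothesis det_neq0 : P 0 iz0 * R 0 iz1 - P 0 iz1 * R 0 iz0 != 0.
Hypotheses (FP : quartic_at Q P = 0) (FR : quartic_at Q R = 0).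
Hypotheses (dPR : dquartic Q P R = 0) (dRP : dquartic Q R P = 0).
Hypothesis B01 : lineB Q P R 0 1 = 0.
Hypotheses (C10 : lineC Q P R 1 0 != 0) (res_neq0 : line_resultant Q P R != 0).
Hypothesis disc_neq0 : tdisc (bisection Q P R) != 0.

(** [tdisc_tangent] at the point above [P]: up to sign the discriminant is [lineC] there times a
    power of [u], hence nonzero by [C10]. *)
Lemma line_fibre_smooth u : u != 0 -> tdisc (line_fibre Q P R u 0) != 0.
Proof.
move=> u0; have := line_point_eval FP FR dPR dRP u 0.
rewrite expr0n mulr0 => on_u; rewrite (tdisc_tangent _ on_u) // oppr_eq0.
have -> : TVec 0 (tz (tgrad (line_fibre Q P R u 0) (line_point P R u 0)))
    (- ty (tgrad (line_fibre Q P R u 0) (line_point P R u 0)))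
    = tscale (u ^+ 3) (tangent_dir Q P).
  rewrite /line_fibre /line_point /tangent_dir /tscale !mulr0 !addr0.
  rewrite ![_ * u]mulrC /= !bform_scale; congr TVec; ring.
rewrite teval_scale mulf_neq0 ?expf_neq0 // -/(lineC Q P R u 0) lineC_expand.
by rewrite mulr0 expr0n mulr0 !addr0 mulf_neq0 ?expf_neq0.
Qed.

(** A common zero over [K] would kill the image of the resultant under the injective [f]. *)
Lemma base_change_neq0 (K : fieldType) (f : {rmorphism k -> K}) u v :
  (u != 0) || (v != 0) ->
  let c := fibre f Q (f (P 0 iz0) * u + f (R 0 iz0) * v)
    (f (P 0 iz1) * u + f (R 0 iz1) * v) in
  (t11 c != 0) || (t22 c != 0).
Proof.
move=> uv; rewrite /= -negb_and; apply/negP => /andP[].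
rewrite !bform2_line => /eqP h11 /eqP h22; case/negP: res_neq0.
rewrite -(fmorph_eq0 f) -(resultant2_root uv h11 h22) /line_resultant /=.
by rewrite /resultant2 !(rmorphB, rmorphXn, rmorphM) /= !rmorph_bform !rmorphD.
Qed.

(** Vanishing at v = 0, u and -u already forces all three coefficients to be zero, as 2 is
    invertible. *)
Lemma line_quadratic_neq0 (c : 'I_3 -> k) (u : k) : u != 0 ->
  [|| bform c (P 0 iz0) (P 0 iz1) != 0,
      bform c (P 0 iz0 + R 0 iz0) (P 0 iz1 + R 0 iz1)
        - bform c (P 0 iz0) (P 0 iz1) - bform c (R 0 iz0) (R 0 iz1) != 0
    | bform c (R 0 iz0) (R 0 iz1) != 0] ->
  exists v, bform c (P 0 iz0 * u + R 0 iz0 * v) (P 0 iz1 * u + R 0 iz1 * v) != 0.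
Proof.
set s0 := bform _ _ _; set s1 := _ - _; set s2 := bform c (R 0 iz0) _ => u0 s.
apply: NNPP => nv; have z v : s0 * u ^+ 2 + s1 * u * v + s2 * v ^+ 2 = 0.
  by apply: NNPP => h; apply: nv; exists v; apply/eqP; rewrite bform2_line.
have s00 : s0 = 0.
  by apply: (mulIf (expf_neq0 2 u0)); rewrite mul0r -[RHS](z 0); ring.
have s20 : s2 = 0.
  apply: (mulIf (mulf_neq0 two_neq0 (expf_neq0 2 u0))).
  by rewrite mul0r -[RHS](addr0 0) -{1}(z u) -(z (- u)) s00; ring.
have s10 : s1 = 0.
  by apply: (mulIf (expf_neq0 2 u0)); rewrite mul0r -[RHS](z u) s00 s20; ring.
by rewrite s00 s10 s20 eqxx in s.
Qed.

(** For fixed [u] these are four nonzero polynomials in [v]; the discriminant and [lineC] are seen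
    to be nonzero at v = 0, on the fibre of [P]. *)
Lemma line_good_fibres u : u != 0 -> exists s : seq k, forall v, v \notin s ->
  let c := line_fibre Q P R u v in
  [/\ tdisc c != 0, t11 c != 0, t22 c != 0 & lineC Q P R u v != 0].
Proof.
move=> u0; pose F : tform {poly k} := fibre polyC Q
  ((P 0 iz0)%:P * u%:P + (R 0 iz0)%:P * 'X) ((P 0 iz1)%:P * u%:P + (R 0 iz1)%:P * 'X).
have evF v : tmap (horner_eval v) F = line_fibre Q P R u v.
  rewrite (@tmap_fibre _ _ _ _ (horner_eval v) id) => [|a]; last exact: hornerC.
  by rewrite /line_fibre /= /horner_eval !hornerE.
pose d := tangent_dir Q P.
pose Cp := teval F (TVec (tx d)%:P (ty d)%:P (tz d)%:P).
have evC v : Cp.[v] = lineC Q P R u v.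
  rewrite -/(horner_eval v Cp) teval_map evF /lineC; congr (teval _ _).
  by rewrite -[RHS]/(TVec (tx d) (ty d) (tz d)); congr TVec; exact: hornerC.
have evD v : (tdisc F).[v] = tdisc (line_fibre Q P R u v).
  by rewrite -/(horner_eval v _) tdisc_map evF.
have ev11 v : (t11 F).[v] = t11 (line_fibre Q P R u v) by rewrite -evF.
have ev22 v : (t22 F).[v] = t22 (line_fibre Q P R u v) by rewrite -evF.
have nz (p : {poly k}) : (exists v, p.[v] != 0) -> p != 0.
  by case=> v; apply: contra_neq => ->; rewrite horner0.
have [] := @all_roots_seq k [:: tdisc F; t11 F; t22 F; Cp].
  rewrite /= !nz //.
  - exists 0; rewrite evC lineC_expand mulr0 expr0n mulr0 !addr0.
    by rewrite mulf_neq0 ?expf_neq0.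
  - have [|v hv] := @line_quadratic_neq0 (sigma22 Q 0) u u0; last first.
      by exists v; rewrite ev22.
    apply: contraNT res_neq0; rewrite !negb_or !negbK => /and3P[/eqP h0 /eqP h1 /eqP h2].
    by rewrite /line_resultant /resultant2 /= h1 h0 h2; apply/eqP; ring.
  - have [|v hv] := @line_quadratic_neq0 (sigma11 Q 0) u u0; last first.
      by exists v; rewrite ev11.
    apply: contraNT res_neq0; rewrite !negb_or !negbK => /and3P[/eqP h0 /eqP h1 /eqP h2].
    by rewrite /line_resultant /resultant2 /= h1 h0 h2; apply/eqP; ring.
  by exists 0; rewrite evD line_fibre_smooth.
move=> s hs; exists s => v vs.
have out p : p \in [:: tdisc F; t11 F; t22 F; Cp] -> p.[v] != 0.
  by move=> /hs; rewrite /root => h; apply: contra vs => /h.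
by split; rewrite -?evD -?ev11 -?ev22 -?evC out // !inE eqxx ?orbT.
Qed.

Lemma unirational_of_bitangent_line : unirational Q.
Proof.
have [xi [nxi bxi]] := C1_conic_point k_C1 (bisection Q P R).
apply: (@unirational_of_sections k k_inf two_neq0 Q (P 0 iz0) (P 0 iz1) (R 0 iz0)
  (R 0 iz1) (bisection Q P R) xi (bisection_point Q P R)) => //.
- by move=> K f u v; apply: base_change_neq0.
- move=> n X [X0 X1 X2].
  have pC : polyfun (fun t => lineC Q P R (tx (X t)) (ty (X t))).
    rewrite /lineC /line_fibre /teval /=.
    by do ![apply: polyfun_bform | progress polyfun_tac].
  by split; rewrite /bisection_point /=; polyfun_tac.
- by move=> X; apply: bisection_point_on.
move=> u u0; have [s hs] := line_good_fibres u0; exists s => v vs w.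
have [dc h11 h22 hC] := hs v vs; split=> //.
case=> /= /eqP + _ _; rewrite mulf_eq0 (negPf hC) orbF.
have -> : (4 : k) = 2 * 2 by ring.
by rewrite mulf_eq0 (negPf two_neq0).
Qed.

End UnirationalLine.

(** * General bundles with a given bitangent plane *)

Lemma quartic_at_phi (k : fieldType) (Q : conic_bundle k) (p : 'rV[k]_5) :
  quartic_at Q (phi p) = p 0 iy0 ^+ 2 * (map_mpoly idfun (conic_eq Q)).@[fun i => p 0 i].
Proof. by rewrite -quartic_phi meval_map_mpoly -meval_quartic. Qed.

Lemma gradient_iz2 (k : fieldType) (Q : conic_bundle k) (z : 'rV[k]_4) :
  gradient (quartic Q) z 0 iz2 =
  ty (tgrad (fibre id Q (z 0 iz0) (z 0 iz1)) (TVec 1 (z 0 iz2) (z 0 iz3))).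
Proof. by rewrite gradientE tderivE dfibre0 /tdot !eqxx /=; ring. Qed.

Lemma gradient_iz3 (k : fieldType) (Q : conic_bundle k) (z : 'rV[k]_4) :
  gradient (quartic Q) z 0 iz3 =
  tz (tgrad (fibre id Q (z 0 iz0) (z 0 iz1)) (TVec 1 (z 0 iz2) (z 0 iz3))).
Proof. by rewrite gradientE tderivE dfibre0 /tdot !eqxx /=; ring. Qed.

Lemma eq_kermx_row (k : fieldType) (n : nat) (a b : 'rV[k]_n) :
  a != 0 -> b != 0 -> (kermx a^T == kermx b^T)%MS -> exists2 m, m != 0 & b = m *: a.
Proof.
move=> a0 b0 /andP[/sub_kermxP ab _].
have [i ai] : exists i, a 0 i != 0.
  by apply: NNPP => h; case/eqP: a0; apply/rowP => i; rewrite mxE;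
     apply: NNPP => ai; apply: h; exists i; apply/eqP.
have bE : b = (b 0 i / a 0 i) *: a.
  apply/rowP => j; rewrite mxE; apply: (mulfI ai).
  (* [T] is orthogonal to [a], hence to [b], which is proportionality of the entries [i] and [j]. *)
  pose T : 'rV[k]_n := a 0 i *: delta_mx 0 j - a 0 j *: delta_mx 0 i.
  have TE (c : 'rV[k]_n) : (T *m c^T) 0 0 = a 0 i * c 0 j - a 0 j * c 0 i.
    by rewrite mulmxBl -!scalemxAl -!rowE !mxE.
  have /sub_kermxP/submxP[S TS] : T *m a^T = 0.
    by apply/matrixP => x y; rewrite !ord1 TE mxE mulrC subrr.
  have /(congr1 (fun M : 'M[k]_1 => M 0 0)) : T *m b^T = 0.
    by rewrite TS -mulmxA ab mulmx0.
  by rewrite TE mxE => /subr0_eq ->; rewrite [b 0 i / _]mulrC !mulrA divff ?mul1r 1?mulrC.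
exists (b 0 i / a 0 i) => //; apply: contra_neq b0 => m0.
by rewrite bE m0 scale0r.
Qed.

Lemma kermx_scale_row (k : fieldType) (n : nat) (a : 'rV[k]_n) (m : k) :
  m != 0 -> (kermx a^T == kermx (m *: a)^T)%MS.
Proof.
move=> m0; rewrite linearZ /=; apply/andP; split; apply/sub_kermxP.
  by rewrite -scalemxAr mulmx_ker scaler0.
by have := mulmx_ker (m *: a^T); rewrite -scalemxAr => /eqP;
   rewrite scaler_eq0 (negPf m0) => /eqP.
Qed.

Lemma bitangent_facts (k : fieldType) (Q : conic_bundle k) (p q : 'rV[k]_5) :
  bitangent Q p q ->
  let P := phi p in let R := phi q in
  [/\ P 0 iz0 * R 0 iz1 - P 0 iz1 * R 0 iz0 != 0, quartic_at Q P = 0,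
      quartic_at Q R = 0, gradient (quartic Q) P != 0
    & exists2 m, m != 0 & gradient (quartic Q) R = m *: gradient (quartic Q) P].
Proof.
case=> [[[_ cp] p0] [[_ cq] q0] pq [gp gq] tpq] P R; split=> //.
- have [-> -> _ _] := phiE p; have [-> -> _ _] := phiE q.
  have -> : p 0 ix0 * p 0 iy0 * (q 0 ix1 * q 0 iy0) - p 0 ix1 * p 0 iy0 *
     (q 0 ix0 * q 0 iy0) = (p 0 ix0 * q 0 ix1 - p 0 ix1 * q 0 ix0) * (p 0 iy0 * q 0 iy0).
    by ring.
  by rewrite !mulf_neq0 // subr_eq0.
- by rewrite quartic_at_phi; have -> := cp; rewrite mulr0.
- by rewrite quartic_at_phi; have -> := cq; rewrite mulr0.
exact: eq_kermx_row.
Qed.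

Lemma dquartic_scale (k : fieldType) (Q : conic_bundle k) (z w : 'rV[k]_4) m t :
  gradient (quartic Q) w = m *: gradient (quartic Q) z ->
  dquartic Q w t = m * dquartic Q z t.
Proof.
by move=> g; rewrite /dquartic mulr_sumr; apply: eq_bigr => i _; rewrite g mxE mulrA.
Qed.

Lemma unirational_of_bitangent (k : fieldType) (k_inf : infinite_field k)
    (k_C1 : C1_field k) (two_neq0 : (2 : k) != 0) (Q : conic_bundle k) (p q : 'rV[k]_5) :
  bitangent Q p q ->
  lineC Q (phi p) (phi q) 1 0 * line_resultant Q (phi p) (phi q)
    * tdisc (bisection Q (phi p) (phi q)) != 0 ->
  unirational Q.
Proof.
move=> /bitangent_facts /= [det0 FP FR _ [m m0 gR]].
rewrite !mulf_eq0 !negb_or => /andP[/andP[C0 r0] d0].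
(* By Euler's relation [phi q] lies on its own tangent plane, hence on that of [phi p]. *)
have dPR : dquartic Q (phi p) (phi q) = 0.
  by apply: (mulfI m0); rewrite -(dquartic_scale _ gR) dquartic_diag FR !mulr0.
have dRP : dquartic Q (phi q) (phi p) = 0.
  by rewrite (dquartic_scale _ gR) dquartic_diag FP !mulr0.
apply: (unirational_of_bitangent_line k_inf k_C1 two_neq0 det0 FP FR dPR dRP _ C0 r0 d0).
have scale i : gradient (quartic Q) (phi q) 0 i = m * gradient (quartic Q) (phi p) 0 i.
  by rewrite gR [in LHS]mxE.
have := scale iz3; have := scale iz2; rewrite !gradient_iz2 !gradient_iz3.
rewrite /lineB /line_fibre /line_point !mulr0 !mulr1 !add0r /tangent_dir.
case: (tgrad _ (TVec 1 (phi q 0 iz2) (phi q 0 iz3))) => c0 c1 c2.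
case: (tgrad _ _) => b0 b1 b2; rewrite /tdot /= => -> ->.
by ring.
Qed.

(** * A model bundle with prescribed tangent plane *)

(* Such an e is the value of a binary form of degree d with coefficients in k, over
   all k-algebras at once. *)
Definition is_bform (k : fieldType) (d : nat)
    (e : forall R : comNzRingType, {rmorphism k -> R} -> R -> R -> R) : Prop :=
  exists c : 'rV[k]_d.+1, forall (R : comNzRingType) (f : {rmorphism k -> R}) x0 x1,
    bform (fun i => f (c 0 i)) x0 x1 = e R f x0 x1.

Lemma is_bform1 (k : fieldType) : @is_bform k 0 (fun _ _ _ _ => 1).
Proof.
exists (\row_i 1) => R f x0 x1.
by rewrite /bform big_ord_recl big_ord0 mxE rmorph1 /= !expr0 addr0 !mul1r.
Qed.

Lemma is_bformD (k : fieldType) d e e' :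
  @is_bform k d e -> is_bform d e' ->
  is_bform d (fun R f x0 x1 => e R f x0 x1 + e' R f x0 x1).
Proof.
move=> [c hc] [c' hc']; exists (c + c') => R f x0 x1.
rewrite -hc -hc' /bform -big_split; apply: eq_bigr => i _ /=.
by rewrite mxE rmorphD mulrDl.
Qed.

Lemma is_bformZ (k : fieldType) d a e :
  @is_bform k d e -> is_bform d (fun R f x0 x1 => f a * e R f x0 x1).
Proof.
move=> [c hc]; exists (a *: c) => R f x0 x1.
rewrite -hc /bform mulr_sumr; apply: eq_bigr => i _ /=.
by rewrite mxE rmorphM -[LHS]mulrA.
Qed.

Lemma is_bformM (k : fieldType) d l0 l1 e :
  @is_bform k d e -> is_bform d.+1 (fun R f x0 x1 => (f l0 * x0 + f l1 * x1) * e R f x0 x1).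
Proof.
move=> [c hc].
(* The two terms of the linear form shift the coefficients by 0 and by 1; the tests put 0 at the end
   that falls out of range. *)
exists (\row_(i < d.+2) (l0 * (if (i <= d)%N then c 0 (inord i) else 0)
  + l1 * (if i == 0%N :> nat then 0 else c 0 (inord i.-1)))) => R f x0 x1.
rewrite -hc /bform mulrDl.
rewrite (eq_bigr (fun i : 'I_d.+2 =>
  f l0 * x0 * (f (if (i <= d)%N then c 0 (inord i) else 0) * (x0 ^+ (d - i) * x1 ^+ i))
  + f l1 * (f (if i == 0%N :> nat then 0 else c 0 (inord i.-1))
       * (x0 ^+ (d.+1 - i) * x1 ^+ i)))) => [|i _]; last first.
  rewrite mxE rmorphD !rmorphM; case: leqP => hi.
    by rewrite subSn // exprS; ring.
  by rewrite rmorph0; ring.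
rewrite big_split -!mulr_sumr /=; congr (_ + _).
  rewrite big_ord_recr /= ltnn rmorph0 mul0r addr0; congr (_ * _).
  by apply: eq_bigr => i _; rewrite -ltnS ltn_ord inord_val.
rewrite -mulrA; congr (_ * _).
rewrite big_ord_recl /= rmorph0 mul0r add0r mulr_sumr; apply: eq_bigr => i _.
by rewrite /= add0n inord_val subSS exprS; ring.
Qed.

Lemma quartic_fibre (k : fieldType) (Q : conic_bundle k) :
  quartic Q = teval (fibre (@mpolyC 4 k) Q 'X_iz0 'X_iz1) (TVec 1 'X_iz2 'X_iz3).
Proof.
have bE d (c : 'rV[k]_d.+1) : binary_form c ('X_iz0 : {mpoly k[4]}) 'X_iz1 =
    bform (fun e => (c 0 e)%:MP) 'X_iz0 'X_iz1.
  by apply: eq_bigr => e _; rewrite mul_mpolyC.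
by rewrite /quartic !bE /teval /= expr1n !mulr1.
Qed.

(* A quartic that is double along u = v = 0 and whose tangent planes at the two
   points of the line n = h = 0 with u = 0 or v = 0 are both n = 0. *)
Definition model_quartic (R : pzRingType) (u v n h : R) : R :=
  u ^+ 2 * v ^+ 2 + (u ^+ 3 + v ^+ 3) * n + (u ^+ 2 + v ^+ 2) * h ^+ 2 + u * v * n ^+ 2.

Definition model_fibre (R : pzRingType) (u v ln n2 n3 lh h2 h3 : R) : tform R :=
  TForm (model_quartic u v ln lh)
    ((u ^+ 3 + v ^+ 3) * n2 + 2 * (u ^+ 2 + v ^+ 2) * lh * h2 + 2 * u * v * ln * n2)
    ((u ^+ 3 + v ^+ 3) * n3 + 2 * (u ^+ 2 + v ^+ 2) * lh * h3 + 2 * u * v * ln * n3)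
    ((u ^+ 2 + v ^+ 2) * h2 ^+ 2 + u * v * n2 ^+ 2)
    (2 * (u ^+ 2 + v ^+ 2) * h2 * h3 + 2 * u * v * n2 * n3)
    ((u ^+ 2 + v ^+ 2) * h3 ^+ 2 + u * v * n3 ^+ 2).

Lemma teval_model (R : comPzRingType) (u v ln n2 n3 lh h2 h3 y z : R) :
  teval (model_fibre u v ln n2 n3 lh h2 h3) (TVec 1 y z) =
  model_quartic u v (ln + n2 * y + n3 * z) (lh + h2 * y + h3 * z).
Proof. by rewrite /teval /model_fibre /model_quartic /=; ring. Qed.

(** Assembled from [is_bform] combinators, so that the equation holds over all rings at once: over
    [k] for values on the line, over [{mpoly k[4]}] for the gradient. *)
Lemma ex_model (k : fieldType) (u0 u1 v0 v1 n0 n1 n2 n3 h0 h1 h2 h3 : k) :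
  exists Q : conic_bundle k,
    forall (R : comNzRingType) (f : {rmorphism k -> R}) x0 x1,
    fibre f Q x0 x1 = model_fibre (f u0 * x0 + f u1 * x1) (f v0 * x0 + f v1 * x1)
      (f n0 * x0 + f n1 * x1) (f n2) (f n3) (f h0 * x0 + f h1 * x1) (f h2) (f h3).
Proof.
have one := is_bform1 k.
have U d e := @is_bformM k d u0 u1 e; have V d e := @is_bformM k d v0 v1 e.
have N d e := @is_bformM k d n0 n1 e; have H d e := @is_bformM k d h0 h1 e.
have [c00 e00] := is_bformD (is_bformD (is_bformD (U _ _ (U _ _ (V _ _ (V _ _ one))))
  (is_bformD (U _ _ (U _ _ (U _ _ (N _ _ one)))) (V _ _ (V _ _ (V _ _ (N _ _ one))))))
  (is_bformD (U _ _ (U _ _ (H _ _ (H _ _ one)))) (V _ _ (V _ _ (H _ _ (H _ _ one))))))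
  (U _ _ (V _ _ (N _ _ (N _ _ one)))).
have linear (a b : k) := is_bformD (is_bformD
  (is_bformZ a (is_bformD (U _ _ (U _ _ (U _ _ one))) (V _ _ (V _ _ (V _ _ one)))))
  (is_bformZ (2 * b) (is_bformD (U _ _ (U _ _ (H _ _ one))) (V _ _ (V _ _ (H _ _ one))))))
  (is_bformZ (2 * a) (U _ _ (V _ _ (N _ _ one)))).
have [c01 e01] := linear n2 h2; have [c02 e02] := linear n3 h3.
have constant (a b : k) := is_bformD
  (is_bformZ a (is_bformD (U _ _ (U _ _ one)) (V _ _ (V _ _ one))))
  (is_bformZ b (U _ _ (V _ _ one))).
have [c11 e11] := constant (h2 ^+ 2) (n2 ^+ 2).
have [c12 e12] := constant (2 * h2 * h3) (2 * n2 * n3).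
have [c22 e22] := constant (h3 ^+ 2) (n3 ^+ 2).
exists (ConicBundle c00 c01 c02 c11 c12 c22) => R f x0 x1.
rewrite /fibre /= e00 e01 e02 e11 e12 e22 /model_fibre /model_quartic.
by congr TForm; ring.
Qed.

(** At such a point every term except [(U ^+ 3 + V ^+ 3) * N] vanishes to order two. *)
Lemma mderiv_model (k : fieldType) (m : nat) (U V N H : {mpoly k[m]}) (i : 'I_m)
    (w : 'I_m -> k) :
  N.@[w] = 0 -> H.@[w] = 0 -> U.@[w] * V.@[w] = 0 -> U.@[w] ^+ 3 + V.@[w] ^+ 3 = 1 ->
  (model_quartic U V N H)^`M(i).@[w] = N^`M(i).@[w].
Proof.
move=> Nw Hw UVw UV3; rewrite /model_quartic.
rewrite !(mderivD, mderivM, mderivXn) !(rmorph_nat, mevalD, mevalM, rmorphXn) /=.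
rewrite Nw Hw; move: (U.@[w]) (V.@[w]) UVw UV3 => u v uv uv3.
move: (U^`M(i)).@[w] (V^`M(i)).@[w] (N^`M(i)).@[w] (H^`M(i)).@[w] => du dv dn dh.
transitivity (u * v * (2 * du * v + 2 * u * dv) + (u ^+ 3 + v ^+ 3) * dn); first by ring.
by rewrite uv uv3; ring.
Qed.

Lemma gradient_linear (k : fieldType) (a0 a1 a2 a3 : k) (i : 'I_4) (w : 'I_4 -> k) :
  (a0%:MP * 'X_iz0 + a1%:MP * 'X_iz1 + a2%:MP * 'X_iz2 + a3%:MP * 'X_iz3)^`M(i).@[w] =
  nth 0 [:: a0; a1; a2; a3] i.
Proof.
rewrite !mderivD !mderiv_mulC !mderivXU !mevalD !mevalM !mevalC !rmorph_nat.
by case: i => [[|[|[|[|//]]]] ?]; rewrite /=; ring.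
Qed.

(** In the model, [n] is the linear form with coefficients [a], [u] and [v] are the coordinates dual
    to [P] and [R] in (z_0, z_1), and [h] is another linear form vanishing at both points. The three
    quantities then become constants. *)
Lemma ex_general_bundle (k : fieldType) (two_neq0 : (2 : k) != 0) (P R a : 'rV[k]_4) :
  P 0 iz0 * R 0 iz1 - P 0 iz1 * R 0 iz0 != 0 -> a != 0 ->
  \sum_i a 0 i * P 0 i = 0 -> \sum_i a 0 i * R 0 i = 0 ->
  exists Q : conic_bundle k,
    [/\ gradient (quartic Q) P = a, gradient (quartic Q) R = a
      & lineC Q P R 1 0 * line_resultant Q P R * tdisc (bisection Q P R) != 0].
Proof.
move=> det0 a0; rewrite !big_ord_recl !big_ord0.
have -> : lift (ord0 : 'I_4) (ord0 : 'I_3) = iz1 by apply: val_inj.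
have -> : lift (ord0 : 'I_4) (lift (ord0 : 'I_3) (ord0 : 'I_2)) = iz2.
  by apply: val_inj.
have -> : lift (ord0 : 'I_4) (lift (ord0 : 'I_3) (lift (ord0 : 'I_2) (ord0 : 'I_1)))
    = iz3 by apply: val_inj.
have -> : (ord0 : 'I_4) = iz0 by apply: val_inj.
set A0 := a 0 iz0; set A1 := a 0 iz1; set A2 := a 0 iz2; set A3 := a 0 iz3.
set P0 := P 0 iz0 in det0 *; set P1 := P 0 iz1 in det0 *.
set P2 := P 0 iz2; set P3 := P 0 iz3.
set R0 := R 0 iz0 in det0 *; set R1 := R 0 iz1 in det0 *.
set R2 := R 0 iz2; set R3 := R 0 iz3.
set det := _ - _ in det0; move=> aP aR.
(* (A2, A3) is nonzero, for otherwise [a] would be a form in z_0, z_1 with two independent zeros.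
   Setting [m1] or [m2] to 0 yields both equations; the second one makes the resultant 1. *)
have [m1 [m2 [m12 mm]]] : exists m1 m2, A2 * m1 + A3 * m2 = 1 /\
    (A2 * m1 - A3 * m2) ^+ 2 = 1.
  have [A30|A30] := eqVneq A3 0; last first.
    by exists 0, A3^-1; split; field.
  have [A20|A20] := eqVneq A2 0; last by exists A2^-1, 0; split; field.
  case/eqP: a0; apply/rowP => i; rewrite mxE.
  rewrite A20 A30 in aP aR.
  have {}aP : A0 * P0 + A1 * P1 = 0 by rewrite -[RHS]aP; ring.
  have {}aR : A0 * R0 + A1 * R1 = 0 by rewrite -[RHS]aR; ring.
  have A00 : A0 = 0.
    apply: (mulIf det0); rewrite mul0r.
    have -> : A0 * det = R1 * (A0 * P0 + A1 * P1) - P1 * (A0 * R0 + A1 * R1).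
      by rewrite /det; ring.
    by rewrite aP aR !mulr0 subrr.
  have A10 : A1 = 0.
    apply: (mulIf det0); rewrite mul0r.
    have -> : A1 * det = P0 * (A0 * R0 + A1 * R1) - R0 * (A0 * P0 + A1 * P1).
      by rewrite /det; ring.
    by rewrite aP aR !mulr0 subrr.
  have: i \in [:: iz0; iz1; iz2; iz3] by case: i => [[|[|[|[|//]]]]].
  by rewrite !inE => /or4P[]/eqP->.
(* The values of m2 z_2 - m1 z_3 at the two points, which the terms with [h0] and [h1] cancel. *)
pose kP := m2 * P2 - m1 * P3; pose kR := m2 * R2 - m1 * R3.
pose u0 := R1 / det; pose u1 := - R0 / det; pose v0 := - P1 / det; pose v1 := P0 / det.
pose h0 := - (u0 * kP + v0 * kR); pose h1 := - (u1 * kP + v1 * kR).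
have [Q QE] := ex_model u0 u1 v0 v1 A0 A1 A2 A3 h0 h1 m2 (- m1).
have uP : u0 * P0 + u1 * P1 = 1 by rewrite /u0 /u1 /det; field; exact: det0.
have vP : v0 * P0 + v1 * P1 = 0 by rewrite /v0 /v1 /det; field; exact: det0.
have uR : u0 * R0 + u1 * R1 = 0 by rewrite /u0 /u1 /det; field; exact: det0.
have vR : v0 * R0 + v1 * R1 = 1 by rewrite /v0 /v1 /det; field; exact: det0.
have hE (z0 z1 : k) : h0 * z0 + h1 * z1 =
    - ((u0 * z0 + u1 * z1) * kP + (v0 * z0 + v1 * z1) * kR).
  by rewrite /h0 /h1; ring.
have gE (z : 'rV[k]_4) : (forall (u v n h : k), u = u0 * z 0 iz0 + u1 * z 0 iz1 ->
    v = v0 * z 0 iz0 + v1 * z 0 iz1 ->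
    n = A0 * z 0 iz0 + A1 * z 0 iz1 + A2 * z 0 iz2 + A3 * z 0 iz3 ->
    h = h0 * z 0 iz0 + h1 * z 0 iz1 + m2 * z 0 iz2 + - m1 * z 0 iz3 ->
    [/\ n = 0, h = 0, u * v = 0 & u ^+ 3 + v ^+ 3 = 1]) -> gradient (quartic Q) z = a.
  move=> hz; apply/rowP => i; rewrite mxE quartic_fibre QE teval_model.
  have [n0 hz0 uv0 uv3] := hz _ _ _ _ erefl erefl erefl erefl.
  rewrite mderiv_model ?(mevalD, mevalM, mevalC, mevalXU) //.
  rewrite gradient_linear.
  have: i \in [:: iz0; iz1; iz2; iz3] by case: i => [[|[|[|[|//]]]]].
  by rewrite !inE => /or4P[]/eqP->.
have gP : gradient (quartic Q) P = a.
  apply: gE => u v n h -> -> -> ->; rewrite -/P0 -/P1 -/P2 -/P3 uP vP.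
  split; [by rewrite -[RHS]aP; ring| |by ring|by ring].
  by rewrite hE uP vP /kP; ring.
have gR : gradient (quartic Q) R = a.
  apply: gE => u v n h -> -> -> ->; rewrite -/R0 -/R1 -/R2 -/R3 uR vR.
  split; [by rewrite -[RHS]aR; ring| |by ring|by ring].
  by rewrite hE uR vR /kR; ring.
exists Q; split=> //.
have lfE u v : line_fibre Q P R u v =
    let y1 := P2 * u + R2 * v in let y2 := P3 * u + R3 * v in
    model_fibre u v (- (A2 * y1 + A3 * y2)) A2 A3 (- (m2 * y1 - m1 * y2)) m2 (- m1).
  have sub_line (b0 b1 : k) : b0 * (P0 * u + R0 * v) + b1 * (P1 * u + R1 * v) =
      (b0 * P0 + b1 * P1) * u + (b0 * R0 + b1 * R1) * v by ring.
  rewrite /line_fibre (QE k idfun) /= !sub_line uP uR vP vR hE uP vP hE uR vR.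
  have -> : A0 * P0 + A1 * P1 = - (A2 * P2 + A3 * P3).
    by apply: (eq_of_subr aP); ring.
  have -> : A0 * R0 + A1 * R1 = - (A2 * R2 + A3 * R3).
    by apply: (eq_of_subr aR); ring.
  by congr model_fibre; rewrite /kP /kR; ring.
have dirE : tangent_dir Q P = TVec 0 A3 (- A2).
  by rewrite /tangent_dir -gradient_iz3 -gradient_iz2 gP.
have CE u v : lineC Q P R u v = u ^+ 2 + v ^+ 2.
  rewrite /lineC lfE dirE /teval /=.
  transitivity ((u ^+ 2 + v ^+ 2) * (A2 * m1 + A3 * m2) ^+ 2); first by ring.
  by rewrite m12; ring.
have BE u v : lineB Q P R u v = 0.
  rewrite /lineB lfE dirE /tdot /line_point -/P2 -/P3 -/R2 -/R3 /=.
  by ring.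
have AE : lineA Q P R = 1.
  have -> : lineA Q P R = teval (line_fibre Q P R 1 1) (line_point P R 1 1).
    by rewrite /lineA /quartic_at /line_fibre /line_point !mulr1 !mxE.
  rewrite lfE /line_point -/P2 -/P3 -/R2 -/R3 teval_model /model_quartic.
  by ring.
have fPE : fibre id Q P0 P1 = line_fibre Q P R 1 0.
  by rewrite /line_fibre !mulr1 !mulr0 !addr0.
have fRE : fibre id Q R0 R1 = line_fibre Q P R 0 1.
  by rewrite /line_fibre !mulr1 !mulr0 !add0r.
have fPRE : fibre id Q (P0 + R0) (P1 + R1) = line_fibre Q P R 1 1.
  by rewrite /line_fibre !mulr1.
have -> : line_resultant Q P R = 1.
  rewrite /line_resultant -/P0 -/P1 -/R0 -/R1 fPE fRE fPRE !lfE /resultant2 /=.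
  transitivity ((A2 * m1 - A3 * m2) ^+ 2 * (A2 * m1 + A3 * m2) ^+ 2); first by ring.
  by rewrite mm m12; ring.
have -> : lineC Q P R 1 0 = 1 by rewrite CE; ring.
(* The bisection is here -16 u^2 - 16 v^2 - w^2. *)
have -> : tdisc (bisection Q P R) = - 2 ^+ 10.
  by rewrite /bisection /lineM0 /lineM1 !BE !CE AE /tdisc /=; ring.
by rewrite !mul1r oppr_eq0 expf_neq0.
Qed.

(** * The genericity conditions as polynomials in the datum *)

Lemma eq_polyfun (k : fieldType) (n : nat) (f g : ('I_n -> k) -> k) :
  f =1 g -> polyfun f -> polyfun g.
Proof. by move=> fg [h hf]; exists h => v; rewrite hf fg. Qed.

Definition tformfun (k : fieldType) (n : nat) (c : ('I_n -> k) -> tform k) : Prop :=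
  [/\ polyfun (fun v => t00 (c v)), polyfun (fun v => t01 (c v))
    & polyfun (fun v => t02 (c v))] /\
  [/\ polyfun (fun v => t11 (c v)), polyfun (fun v => t12 (c v))
    & polyfun (fun v => t22 (c v))].

Section PolyFunBitangent.
Variables (k : fieldType) (n : nat).
Implicit Types (c : ('I_n -> k) -> tform k) (y z : ('I_n -> k) -> tvec k).

Lemma polyfun_teval c y : tformfun c -> tpolyfun y -> polyfun (fun v => teval (c v) (y v)).
Proof. by move=> [[? ? ?] [? ? ?]] [? ? ?]; rewrite /teval; polyfun_tac. Qed.

Lemma polyfun_tdot y z : tpolyfun y -> tpolyfun z -> polyfun (fun v => tdot (y v) (z v)).
Proof. by move=> [? ? ?] [? ? ?]; rewrite /tdot; polyfun_tac. Qed.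

Lemma tpolyfun_tgrad c y :
  tformfun c -> tpolyfun y -> tpolyfun (fun v => tgrad (c v) (y v)).
Proof. by move=> [[? ? ?] [? ? ?]] [? ? ?]; split; rewrite /=; polyfun_tac. Qed.

Lemma polyfun_tdisc c : tformfun c -> polyfun (fun v => tdisc (c v)).
Proof. by move=> [[? ? ?] [? ? ?]]; rewrite /tdisc; polyfun_tac. Qed.

Lemma polyfun_bform_coef (d : nat) (c : ('I_n -> k) -> 'I_d.+1 -> k)
    (x0 x1 : ('I_n -> k) -> k) :
  (forall e, polyfun (fun v => c v e)) -> polyfun x0 -> polyfun x1 ->
  polyfun (fun v => bform (c v) (x0 v) (x1 v)).
Proof. by move=> hc h0 h1; apply: polyfun_sum => e; have ? := hc e; polyfun_tac. Qed.

Variables (Q : ('I_n -> k) -> conic_bundle k) (P R : ('I_n -> k) -> 'rV[k]_4).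
Hypothesis Q00 : forall e, polyfun (fun v => sigma00 (Q v) 0 e).
Hypothesis Q01 : forall e, polyfun (fun v => sigma01 (Q v) 0 e).
Hypothesis Q02 : forall e, polyfun (fun v => sigma02 (Q v) 0 e).
Hypothesis Q11 : forall e, polyfun (fun v => sigma11 (Q v) 0 e).
Hypothesis Q12 : forall e, polyfun (fun v => sigma12 (Q v) 0 e).
Hypothesis Q22 : forall e, polyfun (fun v => sigma22 (Q v) 0 e).
Hypothesis polyP : forall i, polyfun (fun v => P v 0 i).
Hypothesis polyR : forall i, polyfun (fun v => R v 0 i).

Lemma tformfun_fibre (x0 x1 : ('I_n -> k) -> k) :
  polyfun x0 -> polyfun x1 -> tformfun (fun v => fibre id (Q v) (x0 v) (x1 v)).
Proof. by move=> h0 h1; split; split; apply: polyfun_bform_coef. Qed.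

Lemma tpolyfun_tangent_dir : tpolyfun (fun v => tangent_dir (Q v) (P v)).
Proof.
have h2 := polyP iz2; have h3 := polyP iz3.
have [? ? ?] : tpolyfun (fun v => tgrad (fibre id (Q v) (P v 0 iz0) (P v 0 iz1))
    (TVec 1 (P v 0 iz2) (P v 0 iz3))).
  apply: tpolyfun_tgrad; first exact: tformfun_fibre.
  by split; rewrite /=; polyfun_tac.
by split; rewrite /tangent_dir /=; polyfun_tac.
Qed.

Lemma tformfun_line_fibre (a b : k) :
  tformfun (fun v => line_fibre (Q v) (P v) (R v) a b).
Proof.
have := polyP iz0; have := polyP iz1; have := polyR iz0; have := polyR iz1 => ? ? ? ?.
by apply: tformfun_fibre; polyfun_tac.
Qed.

Lemma polyfun_lineC (a b : k) : polyfun (fun v => lineC (Q v) (P v) (R v) a b).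
Proof.
apply: polyfun_teval; [exact: tformfun_line_fibre | exact: tpolyfun_tangent_dir].
Qed.

Lemma polyfun_lineB (a b : k) : polyfun (fun v => lineB (Q v) (P v) (R v) a b).
Proof.
apply: polyfun_tdot; last exact: tpolyfun_tangent_dir.
apply: tpolyfun_tgrad; first exact: tformfun_line_fibre.
have := polyP iz2; have := polyP iz3; have := polyR iz2; have := polyR iz3 => ? ? ? ?.
by split; rewrite /=; polyfun_tac.
Qed.

Lemma polyfun_lineA : polyfun (fun v => lineA (Q v) (P v) (R v)).
Proof.
have polyPR i : polyfun (fun v => (P v + R v) 0 i).
  apply: (@eq_polyfun _ _ (fun v => P v 0 i + R v 0 i)); first by move=> v; rewrite mxE.
  exact: polyfunD.
have h2 := polyPR iz2; have h3 := polyPR iz3.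
apply: polyfun_teval; first exact: tformfun_fibre.
by split; rewrite /=; polyfun_tac.
Qed.

Lemma tformfun_bisection : tformfun (fun v => bisection (Q v) (P v) (R v)).
Proof.
have ? := polyfun_lineC 1 0; have ? := polyfun_lineC 0 1; have ? := polyfun_lineC 1 1.
have ? := polyfun_lineA.
have ? : polyfun (fun v => lineM0 (Q v) (P v) (R v)).
  have ? := polyfun_lineB 1 1; have ? := polyfun_lineB 1 (-1).
  by rewrite /lineM0; polyfun_tac.
have ? : polyfun (fun v => lineM1 (Q v) (P v) (R v)).
  have ? := polyfun_lineB 1 1; have ? := polyfun_lineB 1 (-1).
  by rewrite /lineM1; polyfun_tac.
by split; split; rewrite /bisection /=; polyfun_tac.
Qed.

Lemma polyfun_line_resultant : polyfun (fun v => line_resultant (Q v) (P v) (R v)).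
Proof.
have [_ [? _ ?]] := tformfun_fibre (polyP iz0) (polyP iz1).
have [_ [? _ ?]] := tformfun_fibre (polyR iz0) (polyR iz1).
have [_ [? _ ?]] := tformfun_fibre (polyfunD (polyP iz0) (polyR iz0))
  (polyfunD (polyP iz1) (polyR iz1)).
by rewrite /line_resultant /resultant2; polyfun_tac.
Qed.

End PolyFunBitangent.

(** The factors ask that the fibre of [p] miss the point of the double line in the tangent plane,
    that sigma_11 and sigma_22 have no common root, and that the bisection be smooth. *)
Definition general (k : fieldType) (D : datum k) : k :=
  let: (Q, p, q) := D in
  lineC Q (phi p) (phi q) 1 0 * line_resultant Q (phi p) (phi q)
    * tdisc (bisection Q (phi p) (phi q)).

(** Reads a datum off an arbitrary vector, so that [general] becomes a function on the whole
    coordinate space. *)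
Definition datum_of (k : fieldType) (w : 'rV[k]_(22 + 5 + 5)) : datum k :=
  let s : 'rV[k]_(5 + (4 + (4 + (3 + (3 + 3))))) := lsubmx (lsubmx w) in
  let s1 := rsubmx s in let s2 := rsubmx s1 in let s3 := rsubmx s2 in
  let s4 := rsubmx s3 in
  (ConicBundle (lsubmx s) (lsubmx s1) (lsubmx s2) (lsubmx s3) (lsubmx s4) (rsubmx s4),
   rsubmx (lsubmx w), rsubmx w).

Lemma coordsK (k : fieldType) : cancel (@coords k) (@datum_of k).
Proof.
move=> [[[s00 s01 s02 s11 s12 s22] p] q].
by rewrite /coords /datum_of /= !(row_mxKl, row_mxKr).
Qed.

Ltac coordinate_tac := refine (eq_polyfun _ (polyfun_coord _ _)) => v;
  rewrite /= !mxE; reflexivity.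

Lemma polyfun_general (k : fieldType) :
  exists g : {mpoly k[22 + 5 + 5]},
    forall D, g.@[fun i => coords D 0 i] = general D.
Proof.
pose D (v : 'I_(22 + 5 + 5) -> k) := datum_of (\row_i v i).
have polyphi (p : ('I_(22 + 5 + 5) -> k) -> 'rV[k]_5) :
    (forall i, polyfun (fun v => p v 0 i)) -> forall i, polyfun (fun v => phi (p v) 0 i).
  move=> hp i.
  have: i \in [:: iz0; iz1; iz2; iz3] by case: i => [[|[|[|[|//]]]]].
  rewrite !inE => /or4P[]/eqP->.
  - apply: eq_polyfun (polyfunM (hp ix0) (hp iy0)) => v; by have [-> _ _ _] := phiE (p v).
  - apply: eq_polyfun (polyfunM (hp ix1) (hp iy0)) => v; by have [_ -> _ _] := phiE (p v).
  - apply: eq_polyfun (hp iy1) => v; by have [_ _ -> _] := phiE (p v).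
  apply: eq_polyfun (hp iy2) => v; by have [_ _ _ ->] := phiE (p v).
have [g hg] : polyfun (fun v => general (D v)).
  have ? e : polyfun (fun v => sigma00 (D v).1.1 0 e) by coordinate_tac.
  have ? e : polyfun (fun v => sigma01 (D v).1.1 0 e) by coordinate_tac.
  have ? e : polyfun (fun v => sigma02 (D v).1.1 0 e) by coordinate_tac.
  have ? e : polyfun (fun v => sigma11 (D v).1.1 0 e) by coordinate_tac.
  have ? e : polyfun (fun v => sigma12 (D v).1.1 0 e) by coordinate_tac.
  have ? e : polyfun (fun v => sigma22 (D v).1.1 0 e) by coordinate_tac.
  have hp i : polyfun (fun v => phi (D v).1.2 0 i) by apply: polyphi => {}i; coordinate_tac.
  have hq i : polyfun (fun v => phi (D v).2 0 i) by apply: polyphi => {}i; coordinate_tac.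
  apply: polyfunM; first apply: polyfunM.
  - exact: (polyfun_lineC (Q := fun v => (D v).1.1) (P := fun v => phi (D v).1.2)
      (R := fun v => phi (D v).2)).
  - exact: (polyfun_line_resultant (Q := fun v => (D v).1.1)
      (P := fun v => phi (D v).1.2) (R := fun v => phi (D v).2)).
  apply: polyfun_tdisc.
  exact: (tformfun_bisection (Q := fun v => (D v).1.1)
    (P := fun v => phi (D v).1.2) (R := fun v => phi (D v).2)).
exists g => E; rewrite hg; congr general; rewrite /D -[RHS]coordsK; congr datum_of.
by apply/rowP => i; rewrite mxE.
Qed.

(** * Pencils of bundles with a common bitangent plane *)

Definition comb_bundle (k : fieldType) (t : k) (Q Q' : conic_bundle k) : conic_bundle k :=
  ConicBundle ((1 - t) *: sigma00 Q + t *: sigma00 Q')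
    ((1 - t) *: sigma01 Q + t *: sigma01 Q') ((1 - t) *: sigma02 Q + t *: sigma02 Q')
    ((1 - t) *: sigma11 Q + t *: sigma11 Q') ((1 - t) *: sigma12 Q + t *: sigma12 Q')
    ((1 - t) *: sigma22 Q + t *: sigma22 Q').

Lemma coords_comb (k : fieldType) (t : k) (Q Q' : conic_bundle k) (p q : 'rV[k]_5) :
  coords (comb_bundle t Q Q', p, q) = (1 - t) *: coords (Q, p, q) + t *: coords (Q', p, q).
Proof.
have pE (w : 'rV[k]_5) : (1 - t) *: w + t *: w = w by rewrite -scalerDl subrK scale1r.
case: Q Q' => [s00 s01 s02 s11 s12 s22] [s00' s01' s02' s11' s12' s22'].
rewrite /coords !(scale_row_mx, add_row_mx) !pE /=; congr (row_mx (row_mx _ _) _).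
have split_sigma : row_mx ((1 - t) *: s00 + t *: s00') (row_mx ((1 - t) *: s01 + t *: s01')
    (row_mx ((1 - t) *: s02 + t *: s02') (row_mx ((1 - t) *: s11 + t *: s11')
      (row_mx ((1 - t) *: s12 + t *: s12') ((1 - t) *: s22 + t *: s22'))))) =
    (1 - t) *: row_mx s00 (row_mx s01 (row_mx s02 (row_mx s11 (row_mx s12 s22))))
    + t *: row_mx s00' (row_mx s01' (row_mx s02' (row_mx s11' (row_mx s12' s22')))).
  by rewrite !(scale_row_mx, add_row_mx).
exact: split_sigma.
Qed.

Lemma quartic_comb (k : fieldType) (t : k) (Q Q' : conic_bundle k) :
  quartic (comb_bundle t Q Q') = (1 - t)%:MP * quartic Q + t%:MP * quartic Q'.
Proof.
have bE d (c c' : 'rV[k]_d.+1) :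
    bform (fun e => (((1 - t) *: c + t *: c') 0 e)%:MP) ('X_iz0 : {mpoly k[4]}) 'X_iz1 =
    (1 - t)%:MP * bform (fun e => (c 0 e)%:MP) 'X_iz0 'X_iz1
    + t%:MP * bform (fun e => (c' 0 e)%:MP) 'X_iz0 'X_iz1.
  rewrite /bform !mulr_sumr -big_split; apply: eq_bigr => e _ /=.
  by rewrite !mxE mpolyCD !mpolyCM; ring.
rewrite !quartic_fibre /teval /= !bE.
by do 12!move: (bform _ _ _) => ?; ring.
Qed.

Lemma gradient_comb (k : fieldType) (t : k) (Q Q' : conic_bundle k) (z : 'rV[k]_4) :
  gradient (quartic (comb_bundle t Q Q')) z =
  (1 - t) *: gradient (quartic Q) z + t *: gradient (quartic Q') z.
Proof.
have gE (F : {mpoly k[4]}) i : gradient F z 0 i = F^`M(i).@[fun j => z 0 j].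
  by rewrite mxE.
have combE (a b : 'rV[k]_4) i :
    ((1 - t) *: a + t *: b) 0 i = (1 - t) * a 0 i + t * b 0 i by rewrite !mxE.
have dE (F F' : {mpoly k[4]}) i w :
    ((1 - t)%:MP * F + t%:MP * F')^`M(i).@[w] =
    (1 - t) * F^`M(i).@[w] + t * F'^`M(i).@[w].
  by rewrite mderivD !mderiv_mulC mevalD !mevalM !mevalC.
by apply/rowP => i; rewrite combE !gE quartic_comb dE.
Qed.

Lemma quartic_at_gradient (k : fieldType) (two_neq0 : (2 : k) != 0) (Q : conic_bundle k)
    (z : 'rV[k]_4) :
  dquartic Q z z = 0 -> quartic_at Q z = 0.
Proof.
rewrite dquartic_diag; have -> : (4 : k) = 2 * 2 by ring.
by move/eqP; rewrite !mulf_eq0 (negPf two_neq0) => /eqP.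
Qed.

(** Along the pencil the gradient at [phi p] is constant and the one at [phi q] is [(1 - t) * m + t]
    times it, so the plane persists while this factor is nonzero. The points stay on the bundle by
    Euler's relation, 4 being invertible. *)
Lemma bitangent_comb (k : fieldType) (two_neq0 : (2 : k) != 0) (Q Q' : conic_bundle k)
    (p q : 'rV[k]_5) (t m : k) :
  bitangent Q p q -> m != 0 ->
  gradient (quartic Q) (phi q) = m *: gradient (quartic Q) (phi p) ->
  gradient (quartic Q') (phi p) = gradient (quartic Q) (phi p) ->
  gradient (quartic Q') (phi q) = gradient (quartic Q) (phi p) ->
  (1 - t) * m + t != 0 -> bitangent (comb_bundle t Q Q') p q.
Proof.
move=> bt m0 gR gP' gR' mt; have /= [_ FP FR _ _] := bitangent_facts bt.
case: bt => [[[xp _] p0] [[xq _] q0] pq [gp _] _].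
set a := gradient (quartic Q) (phi p) in gR gP' gR' gp *.
have GP : gradient (quartic (comb_bundle t Q Q')) (phi p) = a.
  have comb1 (b c d : 'rV[k]_4) : b = d -> c = d -> (1 - t) *: b + t *: c = d.
    by move=> -> ->; rewrite -scalerDl subrK scale1r.
  by rewrite gradient_comb; apply: comb1.
have GR : gradient (quartic (comb_bundle t Q Q')) (phi q) = ((1 - t) * m + t) *: a.
  have combm (b c d : 'rV[k]_4) :
      b = m *: d -> c = d -> (1 - t) *: b + t *: c = ((1 - t) * m + t) *: d.
    by move=> -> ->; rewrite scalerA -scalerDl.
  by rewrite gradient_comb; apply: combm.
have on (r : 'rV[k]_5) (c : k) : r 0 iy0 != 0 ->
    gradient (quartic (comb_bundle t Q Q')) (phi r) = c *: a ->
    \sum_i a 0 i * phi r 0 i = 0 -> vanishes_at idfun (conic_eq (comb_bundle t Q Q')) r.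
  move=> r0 G ar; have := @quartic_at_gradient _ two_neq0 (comb_bundle t Q Q') (phi r).
  rewrite /dquartic G (eq_bigr (fun i => c * (a 0 i * phi r 0 i))) => [|i _]; last first.
    by rewrite mxE mulrA.
  rewrite -mulr_sumr ar mulr0 quartic_at_phi => /(_ erefl)/eqP.
  by rewrite mulf_eq0 expf_eq0 (negPf r0) => /eqP.
have aP : \sum_i a 0 i * phi p 0 i = 0.
  by rewrite -/(dquartic Q (phi p) (phi p)) dquartic_diag FP mulr0.
have aR : \sum_i a 0 i * phi q 0 i = 0.
  apply: (mulfI m0); rewrite -/(dquartic Q (phi p) (phi q)) -(dquartic_scale _ gR).
  by rewrite dquartic_diag FR !mulr0.
have onp := on p 1 p0 (etrans GP (esym (scale1r a))) aP.
have onq := on q _ q0 GR aR.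
split; [exact: (conj (conj xp onp) p0) | exact: (conj (conj xq onq) q0) | exact: pq | |].
  have nz (b : 'rV[k]_4) : b != 0 -> ((1 - t) * m + t) *: b != 0.
    by move=> b0; rewrite scaler_eq0 negb_or mt.
  by split; [rewrite GP | rewrite GR; apply: nz].
by rewrite /tangent_space GP GR; apply: kermx_scale_row.
Qed.

Lemma general_dense (k : fieldType) (k_inf : infinite_field k) (two_neq0 : (2 : k) != 0) :
  zariski_dense_in (@bitangent_datum k) (fun D => general D != 0).
Proof.
move=> h hU [[Q p] q] bt; have [g hg] := polyfun_general k.
have /= [det0 FP FR gP0 [m m0 gR]] := bitangent_facts bt.
have aP : \sum_i gradient (quartic Q) (phi p) 0 i * phi p 0 i = 0.
  by rewrite -/(dquartic Q (phi p) (phi p)) dquartic_diag FP mulr0.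
have aR : \sum_i gradient (quartic Q) (phi p) 0 i * phi q 0 i = 0.
  apply: (mulfI m0); rewrite -/(dquartic Q (phi p) (phi q)) -(dquartic_scale _ gR).
  by rewrite dquartic_diag FR !mulr0.
have [Q' [gP' gR' gen]] := ex_general_bundle two_neq0 det0 gP0 aP aR.
(* The factor of the gradient at [phi q]; it is 1 at t = 1, so only finitely many [t] are lost. *)
pose e : {poly k} := (1 - 'X) * m%:P + 'X.
have eE t : e.[t] = (1 - t) * m + t by rewrite /e !hornerE.
apply: (@dense_on_line k k_inf _ h g e _ (fun i => coords (Q', p, q) 0 i)).
- by rewrite hg.
- apply/negP => /eqP e0; have := eE 1; rewrite e0 horner0 subrr mul0r add0r => /eqP.
  by rewrite eq_sym oner_eq0.
move=> t; have lE (f : {mpoly k[22 + 5 + 5]}) :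
    f.@[fun i => (1 - t) * coords (Q, p, q) 0 i + t * coords (Q', p, q) 0 i] =
    f.@[fun i => coords (comb_bundle t Q Q', p, q) 0 i].
  by apply: meval_eq => i; rewrite coords_comb !mxE.
rewrite !lE hg eE => gt et; apply: hU gt.
exact: (bitangent_comb two_neq0 bt m0 gR gP' gR' et).
Qed.

Theorem proposition3p2 (k : fieldType) (k_infinite : infinite_field k)
    (k_C1 : C1_field k) (k_char : 2%N \notin [pchar k]) :
  exists U : datum k -> Prop,
    [/\ zariski_open U,
        zariski_dense_in (@bitangent_datum k) U
      & forall Q : conic_bundle k,
          (exists p q : 'rV[k]_5, bitangent Q p q /\ U (Q, p, q)) ->
          unirational Q].
Proof.
have two_neq0 : (2 : k) != 0 by rewrite inE in k_char.
exists (fun D => general D != 0); split.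
- have [g hg] := polyfun_general k; exists [:: g] => D; split=> [gD|[g']].
    by exists g; rewrite ?mem_head ?hg.
  by rewrite mem_seq1 => /eqP->; rewrite hg.
- exact: general_dense.
move=> Q [p [q [bt gen]]].
exact: (unirational_of_bitangent k_infinite k_C1 two_neq0 bt gen).
Qed.
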